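(* Let $m>0$. For every $\varepsilon>0$ there exists $\psi\in\mathcal{H}_+$ with $\|\psi\|=1$, $\int_{\mathbb{R}^3}|\boldsymbol{x}|^2|\psi(\boldsymbol{x})|^2\,d^3\boldsymbol{x}<\infty$ and $\sigma_\psi<\varepsilon$. Equivalently, there is a sequence $\psi_n\in\mathcal{H}_+$ with $\|\psi_n\|=1$ and $\sigma_{\psi_n}\to 0$ as $n\to\infty$.
   Context: Let $\mathcal{H}=L^2(\mathbb{R}^3,\mathbb{C}^4)$ and let $\alpha_1,\alpha_2,\alpha_3,\beta$ be Hermitian $4\times 4$ Dirac matrices, i.e. $\alpha_j\alpha_k+\alpha_k\alpha_j=2\delta_{jk}\mathbb{1}$, $\alpha_j\beta+\beta\alpha_j=0$, $\beta^2=\mathbb{1}$. The free Dirac Hamiltonian (units $\hbar=c=1$, mass $m>0$) is the self-adjoint operator $H_D=-i\boldsymbol{\alpha}\cdot\nabla+\beta m$ on $\mathcal{H}$ with domain $H^1(\mathbb{R}^3,\mathbb{C}^4)$; its spectrum is $(-\infty,-m]\cup[m,\infty)$. $\mathcal{H}_+$ is the positive-energy subspace, i.e. the spectral subspace of $H_D$ for $[m,\infty)$; equivalently, $\psi\in\mathcal{H}_+$ iff for a.e. $\boldsymbol{p}$ the Fourier transform $\widehat\psi(\boldsymbol p)$ is an eigenvector (or zero) of the matrix $\boldsymbol{\alpha}\cdot\boldsymbol{p}+\beta m$ with eigenvalue $E(\boldsymbol p)=\sqrt{\boldsymbol p^2+m^2}$. For $\psi\in\mathcal{H}$ with $\|\psi\|=1$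 and finite second moment, the position uncertainty $\sigma_\psi\ge 0$ is defined by $\sigma_\psi^2=\int d^3\boldsymbol{x}\,\boldsymbol{x}^2|\psi(\boldsymbol{x})|^2-\big|\int d^3\boldsymbol{x}\,\boldsymbol{x}|\psi(\boldsymbol{x})|^2\big|^2$, where $|\psi(\boldsymbol x)|^2=\psi(\boldsymbol x)^\dagger\psi(\boldsymbol x)$. *)

(* Defs.v *)
From HB Require Import structures.
From mathcomp Require Import all_boot all_order all_algebra.
From mathcomp Require Import all_classical all_reals all_analysis.
From mathcomp Require Import complex.
Set Implicit Arguments. Unset Strict Implicit. Unset Printing Implicit Defensive.
Import Order.TTheory GRing.Theory Num.Theory.
Local Open Scope ring_scope.
Local Open Scope classical_set_scope.
Local Open Scope complex_scope.

Definition R3 (R : realType) :=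
  (measurableTypeR R * measurableTypeR R * measurableTypeR R)%type.

Definition leb3 (R : realType) :=
  ((@lebesgue_measure R \x @lebesgue_measure R) \x @lebesgue_measure R)%E.
Arguments leb3 R : clear implicits.

Definition coord (R : realType) (x : R3 R) (j : 'I_3) : R :=
  match val j with 0 => x.1.1 | 1 => x.1.2 | _ => x.2 end.

Definition dot3 (R : realType) (p x : R3 R) : R :=
  \sum_(j < 3) coord p j * coord x j.
Definition sqnorm3 (R : realType) (x : R3 R) : R := dot3 x x.

Definition csq (R : realType) (z : R[i]) : R := (complex.Re z) ^+ 2 + (complex.Im z) ^+ 2.

Definition spinor (R : realType) := R3 R -> 'cV[R[i]]_4.

Definition dens (R : realType) (psi : spinor R) (x : R3 R) : R :=
  \sum_(k < 4) csq (psi x k 0).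

Definition cmeasurable (R : realType) (f : R3 R -> R[i]) : Prop :=
  measurable_fun setT (fun x => complex.Re (f x)) /\ measurable_fun setT (fun x => complex.Im (f x)).

Definition cL2 (R : realType) (f : R3 R -> R[i]) : Prop :=
  cmeasurable f /\ (\int[leb3 R]_x (csq (f x))%:E < +oo)%E.

Definition cL1 (R : realType) (f : R3 R -> R[i]) : Prop :=
  cmeasurable f /\ (\int[leb3 R]_x (Num.sqrt (csq (f x)))%:E < +oo)%E.

Definition inH (R : realType) (psi : spinor R) : Prop :=
  forall k : 'I_4, cL2 (fun x => psi x k 0).

Definition cint (R : realType) (f : R3 R -> R[i]) : R[i] :=
  (Rintegral (leb3 R) setT (fun x => complex.Re (f x)))
    +i* (Rintegral (leb3 R) setT (fun x => complex.Im (f x))).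

Definition expi (R : realType) (t : R) : R[i] := cos t +i* sin t.

Definition invFT (R : realType) (phi : R3 R -> R[i]) (x : R3 R) : R[i] :=
  ((Num.sqrt (2 * pi)) ^- 3)%:C * cint (fun p => expi (dot3 p x) * phi p).

(* g is the (L^2, Fourier--Plancherel) Fourier transform of f, with the
   convention  \hat f(p) = (2 pi)^{-3/2} \int e^{-i p.x} f(x) dx.
   Defined by duality: F is unitary with adjoint F^{-1}, so g = F f iff
   g \in L^2 and <g, phi> = <f, F^{-1} phi> for all phi in L^1 \cap L^2
   (a dense subspace on which F^{-1} is given by the integral above). *)
Definition is_FT (R : realType) (f g : R3 R -> R[i]) : Prop :=
  cL2 g /\
  forall phi : R3 R -> R[i], cL1 phi -> cL2 phi ->
    cint (fun p => conjc (g p) * phi p) = cint (fun x => conjc (f x) * invFT phi x).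

Definition is_FT_spinor (R : realType) (psi psihat : spinor R) : Prop :=
  forall k : 'I_4, is_FT (fun x => psi x k 0) (fun p => psihat p k 0).

Definition hermitian (R : realType) (A : 'M[R[i]]_4) : Prop :=
  map_mx conjc A^T = A.

Definition dirac_matrices (R : realType) (alpha : 'I_3 -> 'M[R[i]]_4)
  (beta : 'M[R[i]]_4) : Prop :=
  [/\ (forall j, hermitian (alpha j)), hermitian beta,
      (forall j k, alpha j * alpha k + alpha k * alpha j
                   = ((j == k)%:R * 2)%:M),
      (forall j, alpha j * beta + beta * alpha j = 0) &
      beta * beta = 1].

Definition dirac_symbol (R : realType) (alpha : 'I_3 -> 'M[R[i]]_4)
  (beta : 'M[R[i]]_4) (m : R) (p : R3 R) : 'M[R[i]]_4 :=
  \sum_(j < 3) (coord p j)%:C *: alpha j + m%:C *: beta.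

Definition energy (R : realType) (m : R) (p : R3 R) : R :=
  Num.sqrt (sqnorm3 p + m ^+ 2).

Definition in_Hplus (R : realType) (alpha : 'I_3 -> 'M[R[i]]_4)
  (beta : 'M[R[i]]_4) (m : R) (psi : spinor R) : Prop :=
  inH psi /\
  exists psihat : spinor R, is_FT_spinor psi psihat /\
    {ae leb3 R, forall p, dirac_symbol alpha beta m p *m psihat p
                          = (energy m p)%:C *: psihat p}.

Definition normalized (R : realType) (psi : spinor R) : Prop :=
  (\int[leb3 R]_x (dens psi x)%:E = 1)%E.

Definition finite_second_moment (R : realType) (psi : spinor R) : Prop :=
  (\int[leb3 R]_x (sqnorm3 x * dens psi x)%:E < +oo)%E.

Definition sigma2 (R : realType) (psi : spinor R) : R :=
  Rintegral (leb3 R) setT (fun x => sqnorm3 x * dens psi x)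
  - \sum_(j < 3) (Rintegral (leb3 R) setT (fun x => coord x j * dens psi x)) ^+ 2.

Definition sigma (R : realType) (psi : spinor R) : R := Num.sqrt (sigma2 psi).

(* Main.v *)
(** The packet has Fourier transform [exp(-b^2 p^2/2) (1 + D(p)/E(p)) chi], where
    [D(p) = alpha.p + beta m] and [beta chi = chi]; since [D^2 = E^2], this is an
    eigenvector of [D(p)] for [E(p)].  As [m/E(p)] is the mean of
    [exp(-s^2 p^2/2)] over a centered normal variable [s] of variance [1/m^2], in
    position space the packet is [A chi + i B (alpha.x) chi] with [A] and [B] explicit
    mixtures of Gaussians of widths [b] and [tau = sqrt(b^2 + s^2)], and its density is
    [(A^2 + |x|^2 B^2) |chi|^2].  The squared norm is at least of order [b^-3], whereas
    by Cauchy-Schwarz the second moment is at most of order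
    [b^-1 + m^-2 mean(tau^-3)]; the mean of [(b/tau)^3] vanishes with [b], and with it
    the quotient of the two. *)
Require Import Defs.
From HB Require Import structures.
From mathcomp Require Import all_boot all_order all_algebra.
From mathcomp Require Import all_classical all_reals all_analysis.
From mathcomp Require Import measurable_realfun complex.
From mathcomp Require Import ring lra.
Import Order.TTheory GRing.Theory Num.Theory.
Import numFieldNormedType.Exports.
Local Open Scope ring_scope.
Local Open Scope classical_set_scope.
Set Implicit Arguments.
Unset Strict Implicit.
Unset Printing Implicit Defensive.

(** Heuristically the smallness is a scaling effect: as [b] tends to 0 the packet lives at momenta
    of order [1/b], where [D/E] approaches the massless symbol [alpha.p/|p|]. This is homogeneous of
    degree 0, and its gradient, of order [1/|p|], is square integrable near 0 in three dimensions,
    so [b] is the only length left. The obstacle is the nonlocal factor [1/E]. Replacing it by a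
    mean of Gaussians makes every quantity explicit in position space: the second moment is
    estimated there directly, without identifying multiplication by [x] with a derivative of the
    Fourier transform, and [is_FT] reduces to Fubini because the packet is integrable. Fourier
    integrals are kept real as long as possible: each is stated as [a * cos (c + th)] for every
    phase [c], a form stable under products and mixtures that carries the real and imaginary parts
    together. The bounds are generous: the norm is bounded below by the single Gaussian coming from
    the [1] in [1 + D/E], and the squared mean position, which only lowers the variance, is
    dropped. *)

Section gaussian.
Context {R : realType}.
Local Notation mu := (@lebesgue_measure R).

Lemma le_integrable_fun d (T : measurableType d) (nu : {measure set T -> \bar R})
    (f g : T -> R) :
  measurable_fun setT f -> (forall x, `|f x| <= g x) ->
  nu.-integrable setT (EFin \o g) -> nu.-integrable setT (EFin \o f).
Proof.
move=> mf fg; apply: le_integrable => //; first exact/measurable_EFinP.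
by move=> x _ /=; rewrite lee_fin (le_trans (fg x))// ler_norm.
Qed.

Lemma integrable_fun_mulr d (T : measurableType d) (nu : {measure set T -> \bar R})
    (k : R) (f : T -> R) :
  nu.-integrable setT (EFin \o f) -> nu.-integrable setT (EFin \o (fun x => k * f x)).
Proof. exact: (@integrableZl _ _ _ nu setT measurableT k (EFin \o f)). Qed.

Lemma integrable_fun_add d (T : measurableType d) (nu : {measure set T -> \bar R})
    (f g : T -> R) :
  nu.-integrable setT (EFin \o f) -> nu.-integrable setT (EFin \o g) ->
  nu.-integrable setT (EFin \o (fun x => f x + g x)).
Proof. exact: (@integrableD _ _ _ nu setT measurableT (EFin \o f) (EFin \o g)). Qed.

(** * The one-dimensional Gaussian and its mass *)

Definition gauss (t x : R) : R := expR (- (x ^+ 2 / (2 * t ^+ 2))).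

Lemma gauss_gt0 t x : 0 < gauss t x. Proof. exact: expR_gt0. Qed.

Lemma measurable_gauss t : measurable_fun setT (gauss t).
Proof.
apply: measurableT_comp => //; apply: measurableT_comp => //.
by apply: measurable_funM.
Qed.

Lemma normal_peakV (t : R) : 0 < t -> (normal_peak t)^-1 = t * Num.sqrt (2 * pi).
Proof.
move=> t0; rewrite /normal_peak invrK -[X in Num.sqrt X]mulr_natl mulrCA.
by rewrite sqrtrM ?sqr_ge0// sqrtr_sqr gtr0_norm.
Qed.

Lemma gauss_normal_pdf t : 0 < t ->
  gauss t = (fun x => (t * Num.sqrt (2 * pi)) * normal_pdf 0 t x).
Proof.
move=> t0; apply/funext => x.
rewrite normal_pdfE ?gt_eqF// -normal_peakV// mulKf ?gt_eqF ?normal_peak_gt0 ?gt_eqF//.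
by rewrite /normal_fun subr0 mulNr -(mulr_natl (t ^+ 2) 2).
Qed.

Lemma integrable_gauss t : 0 < t -> mu.-integrable setT (EFin \o gauss t).
Proof.
move=> t0; rewrite gauss_normal_pdf//.
apply: integrable_fun_mulr; exact: integrable_normal_pdf.
Qed.

Lemma Rintegral_gauss t : 0 < t -> \int[mu]_x gauss t x = t * Num.sqrt (2 * pi).
Proof.
move=> t0; rewrite gauss_normal_pdf// RintegralZl//; last exact: integrable_normal_pdf.
by rewrite /Rintegral integral_normal_pdf mulr1.
Qed.

End gaussian.

(** * Derivatives, decay and integration by parts on the line *)

Section gaussian_fourier.
Context {R : realType}.
Local Notation mu := (@lebesgue_measure R).

(** The fundamental theorem of calculus on [[-(n+1), n+1]] gives a difference of boundary values
    that tends to 0, while dominated convergence, with [|f|] as majorant, gives the integral over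
    the line. This is the integration by parts behind the Gaussian moments. *)
Lemma integral_is_derive (F f : R -> R) :
  (forall x : R, is_derive x 1 F (f x)) -> continuous f ->
  mu.-integrable setT (EFin \o f) ->
  F n%:R @[n --> \oo] --> (0 : R) -> F (- n%:R) @[n --> \oo] --> (0 : R) ->
  \int[mu]_x f x = 0.
Proof.
move=> dF cf fi Fp Fn.
have cF : continuous F.
  by move=> x; apply/differentiable_continuous/derivable1_diffP; apply: ex_derive.
pose f_ n x : \bar R := ((EFin \o f) \_ `[- n.+1%:R, n.+1%:R]) x.
have mfN n : measurable_fun setT (f_ n).
  apply/(measurable_restrictT _ _).1 => //.
  by apply: measurable_funTS; apply: measurable_int fi.
have := @dominated_cvg _ _ _ mu setT measurableT f_ (EFin \o f)
  (EFin \o (Num.norm \o f)) mfN.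
have cvgf x : setT x -> f_ n x @[n --> \oo] --> (EFin \o f) x.
  move=> _; apply: cvg_near_cst; near=> n.
  rewrite /f_ patchE mem_set//= in_itv/=.
  have : `|x| <= n.+1%:R.
    near: n; exists (Num.trunc `|x|) => //= n /= le_n.
    by rewrite (le_trans (ltW (truncnS_gt _)))// ler_nat.
  by rewrite ler_norml.
move=> /(_ cvgf).
have intN : mu.-integrable setT (EFin \o (Num.norm \o f)).
  exact: integrable_norm.
move=> /(_ (fun _ _ => isT) intN).
have dom n x : setT x -> (`|f_ n x| <= (EFin \o (Num.norm \o f)) x)%E.
  move=> _; rewrite /f_ patchE; case: ifPn => //= _; rewrite ?normr0 ?abse0.
  by rewrite lee_fin.
move=> /(_ dom) H.
have E n : (\int[mu]_x f_ n x = (F n.+1%:R - F (- n.+1%:R))%:E)%E.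
  rewrite /f_ -integral_mkcond/= EFinB; apply: continuous_FTC2.
  - by rewrite (@lt_trans _ _ 0)// ?oppr_lt0 ltr0n.
  - exact: continuous_subspaceT.
  - split.
    + by move=> x _; apply: ex_derive.
    + by apply: cvg_at_right_filter; apply: cF.
    + by apply: cvg_at_left_filter; apply: cF.
  - by move=> x _; rewrite derive1E; apply: derive_val.
have : (F n.+1%:R - F (- n.+1%:R))%:E @[n --> \oo] --> (0 : \bar R)%E.
  apply: cvg_EFin; first exact: nearW.
  rewrite -[X in _ --> X]subr0; apply: cvgB.
    by rewrite (cvg_shiftS (fun n => F n%:R)).
  by rewrite (cvg_shiftS (fun n => F (- n%:R))).
move=> H0.
have -> : \int[mu]_x f x = fine (\int[mu]_x (EFin \o f) x)%E by [].
rewrite -(funext E) in H0.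
by rewrite (cvg_unique _ H H0).
Unshelve. all: end_near. Qed.

Lemma is_derive_cos_affine (c p x : R) :
  is_derive x 1 (fun x : R => cos (c + p * x)) (- p * sin (c + p * x)).
Proof.
have H : is_derive x 1 (fun x : R => c + p * x) p.
  apply: is_derive_eq; rewrite /GRing.scale/=; ring.
have := @is_derive1_comp _ cos (fun x => c + p * x) x _ _ (is_derive_cos _) H.
by rewrite mulrC mulrN mulNr.
Qed.

Lemma is_derive_sin_affine (c p x : R) :
  is_derive x 1 (fun x : R => sin (c + p * x)) (p * cos (c + p * x)).
Proof.
have H : is_derive x 1 (fun x : R => c + p * x) p.
  apply: is_derive_eq; rewrite /GRing.scale/=; ring.
have := @is_derive1_comp _ sin (fun x => c + p * x) x _ _ (is_derive_sin _) H.
by rewrite mulrC.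
Qed.

Lemma is_derive_gauss (t x : R) :
  is_derive x 1 (gauss t) (- (x / t ^+ 2) * gauss t x).
Proof.
have H : is_derive x 1 (fun x : R => - (2 * t ^+ 2)^-1 * x ^+ 2) (- (x / t ^+ 2)).
  apply: is_derive_eq; rewrite /GRing.scale/=.
  by rewrite invfM; set u := (t ^+ 2)^-1; field.
have := @is_derive1_comp _ expR (fun x => - (2 * t ^+ 2)^-1 * x ^+ 2) x _ _
  (is_derive_expR _) H.
have E y : - (2 * t ^+ 2)^-1 * y ^+ 2 = - (y ^+ 2 / (2 * t ^+ 2)).
  by rewrite mulNr mulrC.
rewrite [X in is_derive _ _ _ X -> _]mulrC /= E (_ : expR \o _ = gauss t)//.
by apply/funext => y; rewrite /= E.
Qed.

Lemma cos_subpihalf (x : R) : cos (x - pi / 2) = sin x.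
Proof. by rewrite -{2}(subrK (pi / 2) x) sinDpihalf. Qed.

Lemma continuous_gauss t : continuous (gauss t : R -> R).
Proof.
move=> x; apply/differentiable_continuous/derivable1_diffP.
by apply: ex_derive; exact: is_derive_gauss.
Qed.

(* With y = x^2 / (2t^2), use |x| / t = sqrt(2y) and leave a factor exp(- y / 4). *)
Lemma norm_gauss_le (t x : R) : 0 < t -> `|x| * gauss t x <= 2 * t * gauss (2 * t) x.
Proof.
move=> t0; rewrite /gauss.
pose z := x / t.
have -> : `|x| = t * `|z| by rewrite /z normrM normfV (gtr0_norm t0) mulrCA divff ?mulr1// gt_eqF.
have -> : x ^+ 2 / (2 * t ^+ 2) = z ^+ 2 / 2 by rewrite /z; field; rewrite gt_eqF.
have -> : x ^+ 2 / (2 * (2 * t) ^+ 2) = z ^+ 2 / 8 by rewrite /z; field; rewrite gt_eqF.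
suff K : `|z| * expR (- (z ^+ 2 / 2)) <= 2 * expR (- (z ^+ 2 / 8)).
  by move: K; rewrite -(ler_pM2l t0) mulrA mulrCA mulrA.
have -> : - (z ^+ 2 / 2) = - (z ^+ 2 / 8) - (3 / 8) * z ^+ 2 by field.
rewrite expRD mulrCA mulrC ler_pM2r ?expR_gt0// expRN ler_pdivrMr ?expR_gt0//.
have := expR_ge1Dx (3 / 8 * z ^+ 2).
have := sqr_ge0 (`|z| - 1); rewrite -(real_normK (num_real z)).
nra.
Qed.

(** Since [exp y >= y] and [(n+1)^2 >= n+1], the value at [n+1] is at most [2 t^2 / (n+1)]; the
    shift of index matches [harmonic]. *)
Lemma cvg_gauss_nat (t : R) : 0 < t -> gauss t n%:R @[n --> \oo] --> (0 : R).
Proof.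
move=> t0; rewrite -cvg_shiftS.
apply: (@squeeze_cvgr _ _ _ _ (cst 0) (fun n => 2 * t ^+ 2 * harmonic n)).
- apply: nearW => n; rewrite /= ltW ?gauss_gt0//= /gauss expRN.
  have n0 : 0 < n.+1%:R :> R by rewrite ltr0n.
  have n1 : 1 <= n.+1%:R :> R by rewrite ler1n.
  rewrite -lef_pV2 ?posrE ?invr_gt0 ?expR_gt0 ?mulr_gt0 ?exprn_gt0 ?invr_gt0//.
  rewrite invrK invfM invrK.
  apply: le_trans (expR_ge1Dx _); rewrite mulrC.
  apply: (@le_trans _ _ (n.+1%:R ^+ 2 / (2 * t ^+ 2))); last by rewrite lerDr.
  by rewrite ler_pM2r ?invr_gt0 ?mulr_gt0 ?exprn_gt0// expr2 ler_peMl// ltW.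
- exact: cvg_cst.
- by rewrite -[X in _ --> X](mulr0 (2 * t ^+ 2)); apply: cvgMr; exact: cvg_harmonic.
Qed.

Lemma gaussN (t x : R) : gauss t (- x) = gauss t x.
Proof. by rewrite /gauss sqrrN. Qed.

End gaussian_fourier.

(** * Fourier integrals of [gauss t x] and [x * gauss t x], with a free phase *)

Section gaussian_phase.
Context {R : realType}.
Local Notation mu := (@lebesgue_measure R).

Lemma integrable_mul_cos d (T : measurableType d) (nu : {measure set T -> \bar R})
    (u phi : T -> R) :
  measurable_fun setT phi -> nu.-integrable setT (EFin \o u) ->
  nu.-integrable setT (EFin \o (fun x => u x * cos (phi x))).
Proof.
move=> mphi ui; apply: (@le_integrable_fun _ _ _ _ _ (Num.norm \o u)).
- apply: measurable_funM; first exact/measurable_EFinP/(measurable_int nu).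
  apply: measurableT_comp => //; apply: continuous_measurable_fun.
  exact: continuous_cos.
- by move=> x; rewrite normrM /= ler_piMr// cos_max.
- exact: integrable_norm.
Qed.

Lemma measurable_affine (c p : R) : measurable_fun setT (fun x : R => c + p * x).
Proof. by apply: measurable_funD => //; exact: measurable_funM. Qed.

Lemma measurable_affineV (c p : R) : measurable_fun setT (fun x : R => c + x * p).
Proof. by apply: measurable_funD => //; exact: measurable_funM. Qed.

Lemma integrable_id_gauss (t : R) : 0 < t ->
  mu.-integrable setT (EFin \o (fun x => x * gauss t x)).
Proof.
move=> t0; apply: (@le_integrable_fun R _ (measurableTypeR R) mu
  (fun x : R => x * gauss t x) (fun x => 2 * t * gauss (2 * t) x)).
- by apply: measurable_funM => //; exact: measurable_gauss.
- by move=> x; rewrite normrM (gtr0_norm (gauss_gt0 _ _)) norm_gauss_le.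
- by apply: integrable_fun_mulr; apply: integrable_gauss; rewrite mulr_gt0.
Qed.

(* The derivative of gauss t x * cos (c + p * x) integrates to 0. *)
Lemma Rintegral_id_gauss_cos (t c p : R) : 0 < t ->
  \int[mu]_x (x * gauss t x * cos (c + p * x)) =
  - (t ^+ 2 * p * \int[mu]_x (gauss t x * sin (c + p * x))).
Proof.
move=> t0.
have i1 : mu.-integrable setT (EFin \o (fun x => x * gauss t x * cos (c + p * x))).
  by apply: integrable_mul_cos; [exact: measurable_affine|exact: integrable_id_gauss].
have i2 : mu.-integrable setT (EFin \o (fun x => gauss t x * sin (c + p * x))).
  have := @integrable_mul_cos _ _ mu (gauss t) (fun x => c - pi / 2 + p * x)
    (measurable_affine _ _) (integrable_gauss t0).
  by under eq_fun do rewrite /= addrAC cos_subpihalf.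
pose F x := gauss t x * cos (c + p * x).
pose f x := - (t ^+ 2)^-1 * (x * gauss t x * cos (c + p * x))
            + - p * (gauss t x * sin (c + p * x)).
have H : \int[mu]_x f x = 0.
  apply: (@integral_is_derive _ F).
  - move=> x; have H1 := is_derive_gauss t x; have H2 := is_derive_cos_affine c p x.
    rewrite /f; apply: is_derive_eq; rewrite /GRing.scale/=.
    by rewrite [x / _]mulrC; ring.
  - move=> x; rewrite /f.
    have cc : {for x, continuous (fun x : R => cos (c + p * x))}.
      apply/differentiable_continuous/derivable1_diffP.
      by apply: ex_derive; exact: is_derive_cos_affine.
    have cs : {for x, continuous (fun x : R => sin (c + p * x))}.
      apply/differentiable_continuous/derivable1_diffP.
      by apply: ex_derive; exact: is_derive_sin_affine.
    apply: cvgD; apply: cvgMr; apply: cvgM => //.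
    + by apply: cvgM; [exact: cvg_id|exact: continuous_gauss].
    + exact: continuous_gauss.
  - by rewrite /f; apply: integrable_fun_add; exact: integrable_fun_mulr.
  - apply: norm_cvg0; apply: (@squeeze_cvgr _ _ _ _ (cst 0) (fun n => gauss t n%:R)).
    + apply: nearW => n; rewrite normr_ge0/= normrM (gtr0_norm (gauss_gt0 _ _)).
      by rewrite ler_piMr ?cos_max// ltW// gauss_gt0.
    + exact: cvg_cst.
    + exact: cvg_gauss_nat.
  - apply: norm_cvg0; apply: (@squeeze_cvgr _ _ _ _ (cst 0) (fun n => gauss t n%:R)).
    + apply: nearW => n; rewrite normr_ge0/= normrM (gtr0_norm (gauss_gt0 _ _)).
      by rewrite gaussN ler_piMr ?cos_max// ltW// gauss_gt0.
    + exact: cvg_cst.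
    + exact: cvg_gauss_nat.
move: H; rewrite /f RintegralD//; try exact: integrable_fun_mulr.
rewrite !RintegralZl// => /eqP; rewrite addr_eq0 => /eqP H.
have t2 : t ^+ 2 != 0 by rewrite expf_neq0// gt_eqF.
apply: (mulfI (x := - (t ^+ 2)^-1)); first by rewrite oppr_eq0 invr_eq0.
by rewrite H; field; rewrite gt_eqF.
Qed.

Lemma Rintegral_id_gauss_sin (t c p : R) : 0 < t ->
  \int[mu]_x (x * gauss t x * sin (c + p * x)) =
  t ^+ 2 * p * \int[mu]_x (gauss t x * cos (c + p * x)).
Proof.
move=> t0; have := Rintegral_id_gauss_cos (c - pi / 2) p t0.
have E x : c - pi / 2 + p * x = c + p * x - pi / 2 by rewrite addrAC.
under eq_Rintegral do rewrite E cos_subpihalf.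
move=> ->; rewrite -mulrN; congr (_ * _).
under eq_Rintegral do rewrite E.
have E2 x : sin (x - pi / 2) = - cos x :> R.
  by rewrite -[in RHS](subrK (pi / 2) x) cosDpihalf opprK.
under eq_Rintegral do rewrite E2 mulrN.
have -> : \int[mu]_x (- (gauss t x * cos (c + p * x))) =
   \int[mu]_x (-1 * (gauss t x * cos (c + p * x))).
  by apply: eq_Rintegral => x _; rewrite mulN1r.
rewrite RintegralZl ?mulN1r ?opprK//.
by apply: integrable_mul_cos; [exact: measurable_affine|exact: integrable_gauss].
Qed.

(** Differentiation under the integral sign, with the majorant [|x * gauss t x|] independent of [p],
    produces the sine integral of [x * gauss t x], which integration by parts turns back into the
    original one. The transform thus solves [F' = - t^2 p F]. *)
Lemma is_derive_gauss_fourier (t c p : R) : 0 < t ->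
  is_derive p 1 (fun p : R => \int[mu]_x (gauss t x * cos (c + p * x)))
    (- (t ^+ 2 * p) * \int[mu]_x (gauss t x * cos (c + p * x))).
Proof.
move=> t0.
pose f (p x : R) := gauss t x * cos (c + x * p).
have df (q x : R) : is_derive q 1 (f ^~ x) (- (x * gauss t x * sin (c + x * q))).
  have H := is_derive_cos_affine c x q.
  rewrite /f; apply: is_derive_eq; rewrite /GRing.scale/=; ring.
have d1f (q x : R) : partial1of2 f q x = - (x * gauss t x * sin (c + x * q)).
  by rewrite partial1of2E; exact: derive_val.
have Ip : `]p - 1, p + 1[%classic p by rewrite /= in_itv/=; lra.
have intf x : `]p - 1, p + 1[%classic x -> mu.-integrable setT (EFin \o f x).
  move=> _; apply: integrable_mul_cos; last exact: integrable_gauss.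
  exact: measurable_affineV.
have derf x y : `]p - 1, p + 1[%classic x -> [set: R] y -> derivable (f ^~ y) x 1.
  by move=> _ _; apply: ex_derive.
pose G x := `|x * gauss t x|.
have intG : mu.-integrable setT (EFin \o G).
  by apply: integrable_norm; exact: integrable_id_gauss.
have Gub x y : `]p - 1, p + 1[%classic x -> [set: R] y -> `|partial1of2 f x y| <= G y.
  move=> _ _; rewrite d1f normrN normrM ler_piMr//.
  by rewrite -cos_subpihalf cos_max.
have G0 y : 0 <= G y by exact: normr_ge0.
have E : (fun p : R => \int[mu]_x (gauss t x * cos (c + p * x))) =
   (fun p => \int[mu]_x f p x).
  by apply/funext => q; apply: eq_Rintegral => x _; rewrite /f (mulrC q).
rewrite E; apply: DeriveDef.
  have D := derivable_under_integral measurableT Ip intf derf G0 intG Gub.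
  exact: D.
rewrite -derive1E.
rewrite (differentiation_under_integral measurableT Ip intf derf G0 intG Gub).
rewrite mulNr -Rintegral_id_gauss_sin//.
rewrite -[RHS]mulN1r -RintegralZl//; last first.
  have := @integrable_mul_cos _ _ mu (fun x => x * gauss t x) (fun x => c - pi / 2 + p * x)
    (measurable_affine _ _) (integrable_id_gauss t0).
  by under eq_fun do rewrite /= addrAC cos_subpihalf.
by apply: eq_Rintegral => x _; rewrite d1f mulN1r (mulrC p).
Qed.

(** By the differential equation, the product with [exp(t^2 p^2 / 2)] has zero derivative, so it
    equals its value at [p = 0], the mass of the Gaussian times [cos c]. *)
Lemma gauss_fourier (t c p : R) : 0 < t ->
  \int[mu]_x (gauss t x * cos (c + p * x)) =
  t * Num.sqrt (2 * pi) * expR (- (t ^+ 2 * p ^+ 2 / 2)) * cos c.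
Proof.
move=> t0.
pose F p := \int[mu]_x (gauss t x * cos (c + p * x)).
pose h (p : R) := F p * expR (t ^+ 2 / 2 * p ^+ 2).
have dh (q : R) : is_derive q 1 h 0.
  have H1 := is_derive_gauss_fourier c q t0.
  have H : is_derive q 1 (fun q : R => t ^+ 2 / 2 * q ^+ 2) (t ^+ 2 * q).
    by apply: is_derive_eq; rewrite /GRing.scale/=; field.
  have H2 := @is_derive1_comp _ expR (fun q => t ^+ 2 / 2 * q ^+ 2) q _ _
    (is_derive_expR _) H.
  rewrite /h; apply: is_derive_eq; rewrite /GRing.scale/= -/(F q); ring.
have := is_derive_0_is_cst p 0 dh.
rewrite /h expr0n mulr0 expR0 mulr1 {2}/F.
under eq_Rintegral do rewrite mul0r addr0.
rewrite RintegralZr//; last exact: integrable_gauss.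
rewrite Rintegral_gauss// => H.
rewrite -/(F p) mulrAC -H -[RHS]mulrA -expRD.
by rewrite (_ : _ + _ = 0) ?expR0 ?mulr1//; field.
Qed.

(** The sine is written as a cosine shifted by [pi / 2], which is the pattern required by
    [cos_phase_prod]; the shift is the real form of a factor [i]. *)
Lemma id_gauss_fourier (t c p : R) : 0 < t ->
  \int[mu]_x (x * gauss t x * cos (c + p * x)) =
  t ^+ 3 * Num.sqrt (2 * pi) * p * expR (- (t ^+ 2 * p ^+ 2 / 2)) * cos (c + pi / 2).
Proof.
move=> t0; rewrite Rintegral_id_gauss_cos// cosDpihalf.
under eq_Rintegral do rewrite -cos_subpihalf addrAC.
by rewrite gauss_fourier// cos_subpihalf; ring.
Qed.

End gaussian_phase.

(** * Fubini for real integrals carrying a phase *)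

Section fubini_phase.
Context {R : realType} d1 d2 (T1 : measurableType d1) (T2 : measurableType d2).
Variables (m1 : {sigma_finite_measure set T1 -> \bar R})
          (m2 : {sigma_finite_measure set T2 -> \bar R}).

Lemma integrable_section_EFin d (T : measurableType d) (mu : {measure set T -> \bar R})
    (f : T -> R) : mu.-integrable setT (EFin \o f) ->
  (\int[mu]_x (f x)%:E = (\int[mu]_x f x)%:E)%E.
Proof. by move=> fi; rewrite /Rintegral fineK//; exact: integrable_fin_num. Qed.

(** Sections are asked to be integrable at every point, so that the inner extended-real integral is
    finite and agrees with the real-valued one everywhere. *)
Lemma Rintegral12_prod (f : T1 * T2 -> R) :
  (m1 \x m2)%E.-integrable setT (EFin \o f) ->
  (forall x, m2.-integrable setT (EFin \o (fun y => f (x, y)))) ->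
  \int[(m1 \x m2)%E]_z f z = \int[m1]_x \int[m2]_y f (x, y).
Proof.
move=> fi f2; rewrite /Rintegral; congr fine.
rewrite -(integral12_prod_meas1 fi); apply: eq_integral => x _.
by rewrite /fubini_F /= integrable_section_EFin.
Qed.

Lemma Rintegral21_prod (f : T1 * T2 -> R) :
  (m1 \x m2)%E.-integrable setT (EFin \o f) ->
  (forall y, m1.-integrable setT (EFin \o (fun x => f (x, y)))) ->
  \int[(m1 \x m2)%E]_z f z = \int[m2]_y \int[m1]_x f (x, y).
Proof.
move=> fi f1; rewrite /Rintegral; congr fine.
rewrite -(integral21_prod_meas1 fi); apply: eq_integral => y _.
by rewrite /fubini_G /= integrable_section_EFin.
Qed.

Lemma integrable_prod (f : T1 -> R) (g : T2 -> R) :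
  m1.-integrable setT (EFin \o f) -> m2.-integrable setT (EFin \o g) ->
  (m1 \x m2)%E.-integrable setT (EFin \o (fun z => f z.1 * g z.2)).
Proof.
move=> fi gi.
have mf : measurable_fun setT f by exact/measurable_EFinP/(measurable_int m1).
have mg : measurable_fun setT g by exact/measurable_EFinP/(measurable_int m2).
apply/integrable12ltyP.
  apply/measurable_EFinP; apply: measurable_funM.
    exact: measurableT_comp mf measurable_fst.
  exact: measurableT_comp mg measurable_snd.
rewrite /=; under eq_integral => x _.
  under eq_integral do rewrite normrM EFinM.
  rewrite ge0_integralZl//; last by apply/measurable_EFinP; exact: measurableT_comp.
  rewrite integrable_section_EFin; last exact: integrable_norm.
  over.
rewrite ge0_integralZr//; last 2 first.
- by apply/measurable_EFinP; exact: measurableT_comp.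
- by rewrite lee_fin Rintegral_ge0.
by rewrite integrable_section_EFin ?ltry//; exact: integrable_norm.
Qed.

(** Real form of the multiplicativity of Fourier integrals. Quantifying over [c] is essential: the
    inner integral is evaluated at the phase [c + phi1 x], and the outer one at [c + th2]. *)
Lemma cos_phase_prod (u1 phi1 : T1 -> R) (u2 phi2 : T2 -> R) (a1 a2 th1 th2 : R) :
  measurable_fun setT phi1 -> measurable_fun setT phi2 ->
  m1.-integrable setT (EFin \o u1) -> m2.-integrable setT (EFin \o u2) ->
  (forall c, \int[m1]_x (u1 x * cos (c + phi1 x)) = a1 * cos (c + th1)) ->
  (forall c, \int[m2]_x (u2 x * cos (c + phi2 x)) = a2 * cos (c + th2)) ->
  forall c, \int[(m1 \x m2)%E]_z (u1 z.1 * u2 z.2 * cos (c + (phi1 z.1 + phi2 z.2))) =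
    a1 * a2 * cos (c + (th1 + th2)).
Proof.
move=> mphi1 mphi2 u1i u2i h1 h2 c.
have mc2 x : measurable_fun setT (fun y : T2 => c + (phi1 x + phi2 y)).
  by do 2 apply: measurable_funD => //.
have u2c x : m2.-integrable setT
    (EFin \o (fun y => u2 y * cos (c + (phi1 x + phi2 y)))).
  exact: integrable_mul_cos.
rewrite Rintegral12_prod/=; last 2 first.
- apply: integrable_mul_cos; last exact: integrable_prod.
  apply: measurable_funD => //; apply: measurable_funD.
    exact: measurableT_comp mphi1 measurable_fst.
  exact: measurableT_comp mphi2 measurable_snd.
- by move=> x; under eq_fun do rewrite -mulrA; exact: integrable_fun_mulr.
under eq_Rintegral => x _.
  under eq_Rintegral do rewrite -mulrA.
  rewrite RintegralZl//.
  under eq_Rintegral do rewrite addrA.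
  rewrite h2 mulrCA addrAC.
  over.
rewrite RintegralZl; first by rewrite h1 mulrCA mulrA addrAC -addrA.
- by [].
- apply: integrable_mul_cos => //; exact: measurable_funD.
Qed.

(** By Fubini, the transform of a mixture is the mixture of the transforms. The phase [th] must be
    common to all [y], so that [cos (c + th)] leaves the outer integral. *)
Lemma cos_phase_mix (u : T1 * T2 -> R) (phi : T1 -> R) (a : T2 -> R) (th : R) :
  measurable_fun setT phi ->
  (m1 \x m2)%E.-integrable setT (EFin \o u) ->
  (forall x, m2.-integrable setT (EFin \o (fun y => u (x, y)))) ->
  (forall y, m1.-integrable setT (EFin \o (fun x => u (x, y)))) ->
  m2.-integrable setT (EFin \o a) ->
  (forall y c, \int[m1]_x (u (x, y) * cos (c + phi x)) = a y * cos (c + th)) ->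
  forall c, \int[m1]_x ((\int[m2]_y u (x, y)) * cos (c + phi x)) =
     (\int[m2]_y a y) * cos (c + th).
Proof.
move=> mphi ui u2 u1 ai h c.
have mc : measurable_fun setT (fun x : T1 => c + phi x) by exact: measurable_funD.
transitivity (\int[(m1 \x m2)%E]_z (u z * cos (c + phi z.1))).
  rewrite Rintegral12_prod/=; last 2 first.
  - by apply: integrable_mul_cos => //; exact: measurableT_comp mc measurable_fst.
  - by move=> x; apply: integrable_mul_cos.
  by apply: eq_Rintegral => x _; rewrite RintegralZr.
rewrite Rintegral21_prod/=; last 2 first.
- by apply: integrable_mul_cos => //; exact: measurableT_comp mc measurable_fst.
- by move=> y; exact: integrable_mul_cos.
by under eq_Rintegral do rewrite h; rewrite RintegralZr.
Qed.

Lemma integrable_mix (u : T1 * T2 -> R) :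
  (m1 \x m2)%E.-integrable setT (EFin \o u) ->
  (forall x, m2.-integrable setT (EFin \o (fun y => u (x, y)))) ->
  m1.-integrable setT (EFin \o (fun x => \int[m2]_y u (x, y))).
Proof.
move=> ui u2; have := integrable_fubini_F ui.
apply: eq_integrable => // x _.
by rewrite /fubini_F /= integrable_section_EFin.
Qed.

End fubini_phase.

(** Both exhausting sequences increase, so a point whose coordinates enter at ranks [i] and [j] lies
    in the product set of rank [maxn i j]. *)
Lemma sigma_finite_prod {R : realType} d1 d2 (T1 : measurableType d1)
    (T2 : measurableType d2) (m1 : {sigma_finite_measure set T1 -> \bar R})
    (m2 : {sigma_finite_measure set T2 -> \bar R}) :
  sigma_finite setT (m1 \x m2)%E.
Proof.
have /sigma_finiteP[F [TF leF mF]] := sigma_finiteT m1.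
have /sigma_finiteP[G [TG leG mG]] := sigma_finiteT m2.
exists (fun n => F n `*` G n).
  apply/esym; rewrite -subTset => -[x y] _.
  have [i _ Fix] : (\bigcup_i F i) x by rewrite -TF.
  have [j _ Gjy] : (\bigcup_i G i) y by rewrite -TG.
  exists (maxn i j) => //; split => /=.
    exact: subsetPset (leF _ _ (leq_maxl i j)) _ Fix.
  exact: subsetPset (leG _ _ (leq_maxr i j)) _ Gjy.
move=> n; have [mFn Fn] := mF n; have [mGn Gn] := mG n.
split; first exact: measurableX.
rewrite [X in (X < _)%E](product_measure1E m1 m2 mFn mGn).
apply: lte_mul_pinfty; first exact: measure_ge0.
  by rewrite ge0_fin_numE ?measure_ge0.
exact: Gn.
Qed.

Section lebesgue_plane.
Context {R : realType}.
Local Notation leb1 := (@lebesgue_measure R).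

(* The sigma-finite structure of [m1 \x m2] in the library is shadowed by the
   one for subprobabilities, so the plane measure gets its own name. *)
Definition leb2 := (leb1 \x leb1)%E.

HB.instance Definition _ := Measure.on leb2.
HB.instance Definition _ :=
  Measure_isSigmaFinite.Build _ _ _ leb2 (sigma_finite_prod leb1 leb1).

HB.instance Definition _ := Measure.on (leb3 R).
HB.instance Definition _ :=
  Measure_isSigmaFinite.Build _ _ _ (leb3 R) (sigma_finite_prod leb2 leb1).

End lebesgue_plane.
Arguments leb2 R : clear implicits.

(** * Three-dimensional Gaussians and their Fourier integrals *)

Section gaussian3.
Context {R : realType}.

Local Notation leb1 := (@lebesgue_measure R).

Implicit Types (p x : R3 R) (t : R).

Lemma dot3E p x : dot3 p x = p.1.1 * x.1.1 + p.1.2 * x.1.2 + p.2 * x.2.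
Proof. by rewrite /dot3 !big_ord_recr big_ord0 /= add0r. Qed.

Lemma sqnorm3E x : sqnorm3 x = x.1.1 ^+ 2 + x.1.2 ^+ 2 + x.2 ^+ 2.
Proof. by rewrite /sqnorm3 dot3E !expr2. Qed.

Lemma sqnorm3_ge0 x : 0 <= sqnorm3 x.
Proof. by rewrite sqnorm3E !addr_ge0 ?sqr_ge0. Qed.

Lemma measurable_coord j : measurable_fun setT (fun x : R3 R => Defs.coord x j).
Proof.
have m1 : measurable_fun setT (fun x : R3 R => x.1.1).
  exact: measurableT_comp measurable_fst measurable_fst.
have m2 : measurable_fun setT (fun x : R3 R => x.1.2).
  exact: measurableT_comp measurable_snd measurable_fst.
rewrite /Defs.coord; case: j => -[|[|j]] /= _ //; exact: measurable_snd.
Qed.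

Lemma measurable_dot3 p : measurable_fun setT (dot3 p).
Proof.
have -> : dot3 p = (fun x => \sum_(j < 3) Defs.coord p j * Defs.coord x j) by [].
apply: measurable_sum => j; apply: measurable_funM => //; exact: measurable_coord.
Qed.

Lemma measurable_sqnorm3 : measurable_fun setT (@sqnorm3 R).
Proof.
have -> : @sqnorm3 R = (fun x => \sum_(j < 3) Defs.coord x j * Defs.coord x j) by [].
by apply: measurable_sum => j; apply: measurable_funM; exact: measurable_coord.
Qed.

(** The product form suits Fubini; the radial form in [gauss3E] serves the estimates. *)
Definition gauss3 t x : R := gauss t x.1.1 * gauss t x.1.2 * gauss t x.2.

Lemma gauss3E t x : gauss3 t x = expR (- (sqnorm3 x / (2 * t ^+ 2))).
Proof. by rewrite /gauss3 /gauss -!expRD sqnorm3E !mulrDl !opprD. Qed.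

Lemma gauss3_gt0 t x : 0 < gauss3 t x.
Proof. by rewrite gauss3E expR_gt0. Qed.

Lemma integrable_gauss3 t : 0 < t -> (leb3 R).-integrable setT (EFin \o gauss3 t).
Proof.
move=> t0; have ig := integrable_gauss t0.
exact: (integrable_prod (m1 := leb2 R) (m2 := leb1)
  (integrable_prod (m1 := leb1) (m2 := leb1) ig ig) ig).
Qed.

(** The factor [(2 pi)^(3/2)], inverse to the normalization in [invFT]. *)
Definition gauss3_const : R := Num.sqrt (2 * pi) ^+ 3.

Lemma gauss3_fourier t c p : 0 < t ->
  \int[leb3 R]_x (gauss3 t x * cos (c + dot3 p x)) =
  t ^+ 3 * gauss3_const * expR (- (t ^+ 2 * sqnorm3 p / 2)) * cos c.
Proof.
move=> t0.
have mp (q : R) : measurable_fun setT ( *%R q) by exact: measurable_funM.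
pose G (q : R) := t * Num.sqrt (2 * pi) * expR (- (t ^+ 2 * q ^+ 2 / 2)).
have h (q d : R) : \int[lebesgue_measure]_x (gauss t x * cos (d + q * x)) = G q * cos (d + 0).
  by rewrite addr0 gauss_fourier.
have ig := integrable_gauss t0.
have h12 := cos_phase_prod (m1 := leb1) (m2 := leb1) (mp p.1.1) (mp p.1.2) ig ig (h _) (h _).
have mp12 : measurable_fun setT
    (fun z : measurableTypeR R * measurableTypeR R => p.1.1 * z.1 + p.1.2 * z.2).
  apply: measurable_funD; apply: measurable_funM => //.
have h3 := cos_phase_prod (m1 := leb2 R) (m2 := leb1) mp12 (mp p.2)
  (integrable_prod (m1 := leb1) (m2 := leb1) ig ig) ig h12 (h _).
transitivity (G p.1.1 * G p.1.2 * G p.2 * cos c).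
  have := h3 c; rewrite !addr0 => <-.
  by apply: eq_Rintegral => x _; rewrite dot3E.
congr (_ * _); rewrite /G /gauss3_const sqnorm3E.
have -> : - (t ^+ 2 * (p.1.1 ^+ 2 + p.1.2 ^+ 2 + p.2 ^+ 2) / 2) =
  - (t ^+ 2 * p.1.1 ^+ 2 / 2) - (t ^+ 2 * p.1.2 ^+ 2 / 2) - (t ^+ 2 * p.2 ^+ 2 / 2).
  by field.
by rewrite !expRD; ring.
Qed.

Lemma Rintegral_gauss3 t : 0 < t -> \int[leb3 R]_x gauss3 t x = t ^+ 3 * gauss3_const.
Proof.
move=> t0; have := gauss3_fourier 0 (0, 0, 0) t0.
rewrite sqnorm3E /= expr0n !addr0 mulr0 mul0r oppr0 expR0 cos0 !mulr1 => <-.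
by apply: eq_Rintegral => x _; rewrite dot3E/= !mul0r !addr0 cos0 mulr1.
Qed.

(* The coordinate factor shifts the phase by pi/2. *)
Lemma coord_gauss3_fourier t c p j : 0 < t ->
  \int[leb3 R]_x (Defs.coord x j * gauss3 t x * cos (c + dot3 p x)) =
  t ^+ 5 * gauss3_const * Defs.coord p j * expR (- (t ^+ 2 * sqnorm3 p / 2)) *
  cos (c + pi / 2).
Proof.
move=> t0.
have mp (q : R) : measurable_fun setT ( *%R q) by exact: measurable_funM.
(* The flag marks the axis that carries the coordinate factor, so that one product computation
   covers the three values of [j]. It shadows no width: [t] is the only one here. *)
pose e (b : bool) (y : R) := if b then y else 1.
pose u b y := e b y * gauss t y.
pose G b (q : R) := t * Num.sqrt (2 * pi) * expR (- (t ^+ 2 * q ^+ 2 / 2)) *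
  (if b then t ^+ 2 * q else 1).
pose th b : R := if b then pi / 2 else 0.
have iu b : lebesgue_measure.-integrable setT (EFin \o u b).
  rewrite /u; case: b; first exact: integrable_id_gauss.
  by under eq_fun do rewrite /e mul1r; exact: integrable_gauss.
have h b (q d : R) : \int[lebesgue_measure]_x (u b x * cos (d + q * x)) = G b q * cos (d + th b).
  case: b; rewrite /u /e /G /th.
    by rewrite id_gauss_fourier//; ring.
  by under eq_Rintegral do rewrite mul1r; rewrite addr0 gauss_fourier// mulr1.
pose b1 := val j == 0%N; pose b2 := val j == 1%N; pose b3 := val j == 2%N.
have h12 := cos_phase_prod (m1 := leb1) (m2 := leb1) (mp p.1.1) (mp p.1.2)
  (iu b1) (iu b2) (h _ _) (h _ _).
have mp12 : measurable_fun setT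
    (fun z : measurableTypeR R * measurableTypeR R => p.1.1 * z.1 + p.1.2 * z.2).
  apply: measurable_funD; apply: measurable_funM => //.
have h3 := cos_phase_prod (m1 := leb2 R) (m2 := leb1) mp12 (mp p.2)
  (integrable_prod (m1 := leb1) (m2 := leb1) (iu b1) (iu b2)) (iu b3) h12 (h _ _).
have ej (x : R3 R) : Defs.coord x j = e b1 x.1.1 * e b2 x.1.2 * e b3 x.2.
  rewrite /b1 /b2 /b3 /e /Defs.coord; case: (j) => -[|[|[|//]]] /= _; rewrite ?mulr1 ?mul1r//.
transitivity (G b1 p.1.1 * G b2 p.1.2 * G b3 p.2 * cos (c + (th b1 + th b2 + th b3))).
  rewrite -h3.
  by apply: eq_Rintegral => x _; rewrite dot3E ej /gauss3 /u; congr (_ * _); ring.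
have -> : th b1 + th b2 + th b3 = pi / 2.
  by rewrite /th /b1 /b2 /b3; case: (j) => -[|[|[|//]]] /= _; rewrite ?addr0 ?add0r.
congr (_ * _); rewrite /G /gauss3_const sqnorm3E.
have -> : - (t ^+ 2 * (p.1.1 ^+ 2 + p.1.2 ^+ 2 + p.2 ^+ 2) / 2) =
  - (t ^+ 2 * p.1.1 ^+ 2 / 2) - (t ^+ 2 * p.1.2 ^+ 2 / 2) - (t ^+ 2 * p.2 ^+ 2 / 2).
  by field.
rewrite !expRD ej /e /b1 /b2 /b3.
by case: (j) => -[|[|[|//]]] /= _; ring.
Qed.

End gaussian3.

(** * Mixtures of Gaussians over a normal variable [s] *)

Section gaussian_mixture.
Context {R : realType}.
Local Notation leb1 := (@lebesgue_measure R).
Variables (m b : R).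
Hypotheses (m0 : 0 < m) (b0 : 0 < b).

Definition mixweight (s : R) : R := m / Num.sqrt (2 * pi) * gauss m^-1 s.

Let sqrt2pi_gt0 : 0 < Num.sqrt (2 * pi) :> R.
Proof. by rewrite sqrtr_gt0 mulr_gt0// pi_gt0. Qed.

Lemma gauss3_const_gt0 : 0 < @gauss3_const R.
Proof. by rewrite exprn_gt0. Qed.

Lemma mixweight_gt0 s : 0 < mixweight s.
Proof. by rewrite mulr_gt0 ?gauss_gt0// divr_gt0. Qed.

Lemma integrable_mixweight : leb1.-integrable setT (EFin \o mixweight).
Proof. by apply: integrable_fun_mulr; apply: integrable_gauss; rewrite ?invr_gt0. Qed.

Lemma measurable_mixweight : measurable_fun setT mixweight.
Proof. by apply: measurable_funM => //; exact: measurable_gauss. Qed.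

(** The exponents add up to a Gaussian in [s] of width [1 / sqrt(q + m^2)]. At [q = |p|^2] the value
    is [m / E(p)], which builds the packet; at [q = b^-1] it is small with [b], which controls the
    second moment. *)
Lemma laplace_mixweight (q : R) : 0 <= q ->
  \int[leb1]_s (mixweight s * expR (- (s ^+ 2 * q / 2))) = m / Num.sqrt (q + m ^+ 2).
Proof.
move=> q0; have E0 : 0 < q + m ^+ 2 by rewrite ltr_wpDl ?exprn_gt0.
have S0 : 0 < Num.sqrt (q + m ^+ 2) by rewrite sqrtr_gt0.
transitivity (\int[leb1]_s (m / Num.sqrt (2 * pi) * gauss (Num.sqrt (q + m ^+ 2))^-1 s)).
  apply: eq_Rintegral => s _; rewrite /mixweight /gauss -mulrA -expRD; congr (_ * expR _).
  by rewrite !exprVn sqr_sqrtr ?ltW//; field; rewrite !gt_eqF.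
rewrite RintegralZl//; last by apply: integrable_gauss; rewrite invr_gt0.
by rewrite Rintegral_gauss ?invr_gt0//; field; rewrite !gt_eqF.
Qed.

Lemma Rintegral_mixweight : \int[leb1]_s mixweight s = 1.
Proof.
rewrite RintegralZl//; last by apply: integrable_gauss; rewrite invr_gt0.
by rewrite Rintegral_gauss ?invr_gt0//; field; rewrite !gt_eqF.
Qed.

Definition width (s : R) : R := Num.sqrt (b ^+ 2 + s ^+ 2).

Lemma width_sqr s : width s ^+ 2 = b ^+ 2 + s ^+ 2.
Proof. by rewrite sqr_sqrtr// addr_ge0 ?sqr_ge0. Qed.

Lemma width_gt0 s : 0 < width s.
Proof. by rewrite sqrtr_gt0 ltr_wpDr ?sqr_ge0 ?exprn_gt0. Qed.

Lemma width_ge s : b <= width s.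
Proof.
by rewrite -[leLHS](gtr0_norm b0) -sqrtr_sqr ler_wsqrtr// lerDl sqr_ge0.
Qed.

Lemma measurable_widthV : measurable_fun setT (fun s => (width s)^-1).
Proof.
apply: continuous_measurable_fun => s; apply: cvgV; first by rewrite gt_eqF// width_gt0.
apply: (continuous_comp (f := fun s : R => b ^+ 2 + s ^+ 2) (g := Num.sqrt)).
  apply: cvgD; first exact: cvg_cst.
  exact: exprn_continuous.
exact: sqrt_continuous.
Qed.

Lemma widthVX_le n s : (width s)^-1 ^+ n <= b^-1 ^+ n.
Proof.
apply: lerXn2r; rewrite ?nnegrE ?invr_ge0 ?(ltW b0) ?(ltW (width_gt0 _))//.
by rewrite lef_pV2 ?posrE ?width_gt0// width_ge.
Qed.

Lemma widthVX_gt0 n s : 0 < (width s)^-1 ^+ n.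
Proof. by rewrite exprn_gt0// invr_gt0 width_gt0. Qed.

Lemma integrable_mixweight_bounded (h : R -> R) (C : R) :
  measurable_fun setT h -> (forall s, `|h s| <= C) ->
  leb1.-integrable setT (EFin \o (fun s => mixweight s * h s)).
Proof.
move=> mh hC; apply: (@le_integrable_fun R _ (measurableTypeR R) leb1
  (fun s => mixweight s * h s) (fun s => C * mixweight s)).
- by apply: measurable_funM => //; exact: measurable_mixweight.
- by move=> s; rewrite normrM (gtr0_norm (mixweight_gt0 s)) mulrC ler_wpM2r// ltW// mixweight_gt0.
- by apply: integrable_fun_mulr; exact: integrable_mixweight.
Qed.

(* Cauchy-Schwarz for the probability density mixweight: integrate
   [mixweight s * (h s - c) ^+ 2 >= 0] where c is the mean of h. *)
Lemma sqr_Rintegral_mixweight_le (h : R -> R) (C : R) :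
  measurable_fun setT h -> (forall s, `|h s| <= C) ->
  (\int[leb1]_s (mixweight s * h s)) ^+ 2 <= \int[leb1]_s (mixweight s * h s ^+ 2).
Proof.
move=> mh hC; set c := \int[leb1]_s (mixweight s * h s).
have i1 := integrable_mixweight_bounded mh hC.
have i2 : leb1.-integrable setT (EFin \o (fun s => mixweight s * h s ^+ 2)).
  apply: (@integrable_mixweight_bounded _ (C ^+ 2)); first exact: measurable_funX.
  by move=> s; rewrite normrX lerXn2r// nnegrE (le_trans _ (hC s)).
have i0 := integrable_mixweight.
suff : 0 <= \int[leb1]_s (mixweight s * h s ^+ 2 + ((- 2 * c) * (mixweight s * h s)
        + c ^+ 2 * mixweight s)).
  rewrite RintegralD//; last by apply: integrable_fun_add; exact: integrable_fun_mulr.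
  rewrite RintegralD//; try exact: integrable_fun_mulr.
  rewrite (@RintegralZl _ _ _ leb1 setT mixweight)// Rintegral_mixweight.
  by rewrite RintegralZl// -/c; lra.
apply: Rintegral_ge0 => s _.
rewrite (_ : _ + _ = mixweight s * (h s - c) ^+ 2); last by ring.
by rewrite mulr_ge0 ?sqr_ge0// ltW// mixweight_gt0.
Qed.

(** The factor [(width s)^-3] gives each Gaussian the mass [k^3 * gauss3_const], independent of [s],
    so that integrals over space reduce to means of [h]. The packet uses [k = 1]; the value [k = 2]
    serves only as a majorant once a coordinate has been absorbed. *)
Definition mixkernel (k : R) (h : R -> R) (z : R3 R * measurableTypeR R) : R :=
  mixweight z.2 * (h z.2 * ((width z.2)^-1 ^+ 3 * gauss3 (k * width z.2) z.1)).

Lemma measurable_gauss3_width (k : R) : 0 < k ->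
  measurable_fun setT (fun z : R3 R * measurableTypeR R => gauss3 (k * width z.2) z.1).
Proof.
move=> k0.
have -> : (fun z : R3 R * measurableTypeR R => gauss3 (k * width z.2) z.1) =
  (fun z => expR (- (sqnorm3 z.1 * ((width z.2)^-1 ^+ 2 * (2 * k ^+ 2)^-1)))).
  apply/funext => z; rewrite gauss3E; congr (expR (- (_ * _))).
  by rewrite exprVn; field; rewrite !gt_eqF// width_gt0.
apply: measurableT_comp => //; apply: measurableT_comp => //.
apply: measurable_funM; first exact: measurableT_comp measurable_sqnorm3 measurable_fst.
apply: measurable_funM => //; apply: measurable_funX.
exact: measurableT_comp measurable_widthV measurable_snd.
Qed.

Lemma integrable_mixkernel1 (k : R) h s : 0 < k ->
  (leb3 R).-integrable setT (EFin \o (fun x => mixkernel k h (x, s))).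
Proof.
move=> k0; rewrite /mixkernel /=; do 3 apply: integrable_fun_mulr.
by apply: integrable_gauss3; rewrite mulr_gt0// width_gt0.
Qed.

Lemma Rintegral_mixkernel1 (k : R) h s : 0 < k ->
  \int[leb3 R]_x mixkernel k h (x, s) = k ^+ 3 * gauss3_const * (mixweight s * h s).
Proof.
move=> k0; have kw : 0 < k * width s by rewrite mulr_gt0// width_gt0.
have ig := integrable_gauss3 kw.
rewrite /mixkernel /= !RintegralZl//; try by do ?apply: integrable_fun_mulr.
rewrite Rintegral_gauss3// exprVn exprMn; field.
by rewrite gt_eqF// width_gt0.
Qed.

Section bounded_kernel.
Variables (k C : R) (h : R -> R).
Hypotheses (k0 : 0 < k) (mh : measurable_fun setT h) (hC : forall s, `|h s| <= C).

Lemma measurable_mixkernel : measurable_fun setT (mixkernel k h).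
Proof.
apply: measurable_funM.
  exact: measurableT_comp measurable_mixweight measurable_snd.
apply: measurable_funM; first exact: measurableT_comp mh measurable_snd.
apply: measurable_funM; last exact: measurable_gauss3_width.
apply: measurable_funX; exact: measurableT_comp measurable_widthV measurable_snd.
Qed.

Lemma integrable_mixkernel2 x :
  leb1.-integrable setT (EFin \o (fun s => mixkernel k h (x, s))).
Proof.
rewrite /mixkernel /=; apply: (@integrable_mixweight_bounded _ (C * b^-1 ^+ 3)).
  apply: measurable_funM => //; apply: measurable_funM.
    by apply: measurable_funX; exact: measurable_widthV.
  have := measurableT_comp (measurable_gauss3_width k0) (pair1_measurable x).
  by apply.
move=> s; rewrite normrM ler_pM// normrM (gtr0_norm (widthVX_gt0 _ _)).
rewrite (gtr0_norm (gauss3_gt0 _ _)) -[leRHS]mulr1 ler_pM ?widthVX_le//.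
- by rewrite ltW// widthVX_gt0.
- by rewrite ltW// gauss3_gt0.
- by rewrite gauss3E expR_le1 oppr_le0 divr_ge0 ?sqnorm3_ge0// mulr_ge0// sqr_ge0.
Qed.

(** Tonelli with the space variable first: the absolute value of the kernel is the kernel of [|h|],
    whose inner integral is a constant times [mixweight s * |h s|]. *)
Lemma integrable_mixkernel : (leb3 R \x leb1)%E.-integrable setT (EFin \o mixkernel k h).
Proof.
apply/(@integrable21ltyP _ _ _ _ _ (leb3 R) leb1).
  by apply/measurable_EFinP; exact: measurable_mixkernel.
have E s x : (`|(EFin \o mixkernel k h) (x, s)| = (mixkernel k (Num.norm \o h) (x, s))%:E)%E.
  rewrite /= /mixkernel /= normrM (gtr0_norm (mixweight_gt0 s)) normrM normrM.
  by rewrite (gtr0_norm (widthVX_gt0 3 s)) (gtr0_norm (gauss3_gt0 _ _)).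
have hn : leb1.-integrable setT (EFin \o (fun s => mixweight s * `|h s|)).
  apply: (@integrable_mixweight_bounded (fun s => `|h s|) C).
    exact: measurableT_comp.
  by move=> s; rewrite normr_id.
under eq_integral => s _.
  under eq_integral do rewrite E.
  rewrite (integrable_section_EFin (integrable_mixkernel1 _ _ k0)) Rintegral_mixkernel1//.
  over.
rewrite (integrable_section_EFin (integrable_fun_mulr (k ^+ 3 * gauss3_const) hn)).
exact: ltry.
Qed.

Lemma integrable_Rintegral_mixkernel :
  (leb3 R).-integrable setT (EFin \o (fun x => \int[leb1]_s mixkernel k h (x, s))).
Proof.
apply: (integrable_mix (m1 := leb3 R) (m2 := leb1)); first exact: integrable_mixkernel.
exact: integrable_mixkernel2.
Qed.

Lemma Rintegral_mixkernel :
  \int[leb3 R]_x \int[leb1]_s mixkernel k h (x, s) =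
  k ^+ 3 * gauss3_const * \int[leb1]_s (mixweight s * h s).
Proof.
rewrite -(Rintegral12_prod (m1 := leb3 R) (m2 := leb1) integrable_mixkernel); last first.
  exact: integrable_mixkernel2.
rewrite (Rintegral21_prod (m1 := leb3 R) (m2 := leb1) integrable_mixkernel); last first.
  by move=> y; exact: integrable_mixkernel1.
under eq_Rintegral do rewrite Rintegral_mixkernel1//.
by rewrite RintegralZl//; exact: integrable_mixweight_bounded.
Qed.

End bounded_kernel.

End gaussian_mixture.

(** * Pointwise Gaussian bounds, the coefficients A and B, and the transform of A *)

Section kernels.
Context {R : realType}.
Local Notation leb1 := (@lebesgue_measure R).

Lemma gauss_le (t u x : R) : 0 < t -> t <= u -> gauss t x <= gauss u x.
Proof.
move=> t0 tu; have u0 : 0 < u by exact: lt_le_trans tu.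
rewrite ler_expR lerN2 ler_wpM2l ?sqr_ge0// lef_pV2 ?posrE ?mulr_gt0 ?exprn_gt0//.
by rewrite ler_wpM2l// lerXn2r// ?nnegrE ltW.
Qed.

(** The one-dimensional bound is applied to the factor of axis [j]; the two other factors only grow
    when their width is doubled. *)
Lemma norm_coord_gauss3_le (t : R) (x : R3 R) j : 0 < t ->
  `|Defs.coord x j| * gauss3 t x <= 2 * t * gauss3 (2 * t) x.
Proof.
move=> t0; have t2 : t <= 2 * t by lra.
have g y := gauss_le y t0 t2; have n y := norm_gauss_le y t0.
have p y : 0 <= gauss t y by rewrite ltW// gauss_gt0.
have p2 y : 0 <= gauss (2 * t) y by rewrite ltW// gauss_gt0.
have K (a a' c c' d d' : R) : 0 <= a -> 0 <= c -> 0 <= d -> a <= a' -> c <= c' -> d <= d' ->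
    a * c * d <= a' * c' * d'.
  by move=> *; rewrite ler_pM ?mulr_ge0// ler_pM.
have np (z y : R) : 0 <= `|z| * gauss t y by rewrite mulr_ge0.
rewrite /gauss3 /Defs.coord; case: j => -[|[|[|//]]] /= _.
- by rewrite !mulrA; apply: K; rewrite ?np ?p ?g ?n.
- have := K _ _ _ _ _ _ (np x.1.2 x.1.2) (p x.1.1) (p x.2) (n _) (g _) (g _).
  by move=> h; rewrite [leLHS](_ : _ = `|x.1.2| * gauss t x.1.2 * gauss t x.1.1 * gauss t x.2)
    ?(le_trans h)//; [rewrite le_eqVlt; apply/orP; left; apply/eqP|]; ring.
- have := K _ _ _ _ _ _ (np x.2 x.2) (p x.1.1) (p x.1.2) (n _) (g _) (g _).
  by move=> h; rewrite [leLHS](_ : _ = `|x.2| * gauss t x.2 * gauss t x.1.1 * gauss t x.1.2)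
    ?(le_trans h)//; [rewrite le_eqVlt; apply/orP; left; apply/eqP|]; ring.
Qed.

Lemma gauss3_le1 (t : R) x : gauss3 t x <= 1.
Proof.
by rewrite gauss3E expR_le1 oppr_le0 divr_ge0 ?sqnorm3_ge0// mulr_ge0// sqr_ge0.
Qed.

(** Giving up one Gaussian factor keeps the width unchanged, so that after Cauchy-Schwarz the bound
    is again a mixture of the same family. *)
Lemma gauss3_sqr_le (t : R) x : gauss3 t x ^+ 2 <= gauss3 t x.
Proof. by rewrite expr2 ler_piMr ?gauss3_le1// ltW// gauss3_gt0. Qed.

(* With y = |x|^2 / (2t^2), the next two bounds are y <= exp y and y^2 <= 4 exp y. *)
Lemma sqnorm3_gauss3_sqr_le (t : R) x : 0 < t ->
  sqnorm3 x * gauss3 t x ^+ 2 <= 2 * t ^+ 2 * gauss3 t x.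
Proof.
move=> t0; rewrite gauss3E; set y := sqnorm3 x / (2 * t ^+ 2).
have t2 : 0 < 2 * t ^+ 2 by rewrite mulr_gt0 ?exprn_gt0.
have -> : sqnorm3 x = 2 * t ^+ 2 * y by rewrite /y mulrC divfK// gt_eqF.
have e0 := expR_gt0 (- y).
suff : y * expR (- y) <= 1.
  move=> h; have te : 0 < 2 * t ^+ 2 * expR (- y) by rewrite mulr_gt0.
  have := ler_wpM2r (ltW te) h.
  rewrite (_ : 2 * t ^+ 2 * y * expR (- y) ^+ 2 =
    y * expR (- y) * (2 * t ^+ 2 * expR (- y))); last by ring.
  by lra.
rewrite expRN ler_pdivrMr ?expR_gt0// mul1r.
by have := expR_ge1Dx y; lra.
Qed.

Lemma sqnorm3_sqr_gauss3_sqr_le (t : R) x : 0 < t ->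
  sqnorm3 x ^+ 2 * gauss3 t x ^+ 2 <= 16 * t ^+ 4 * gauss3 t x.
Proof.
move=> t0; rewrite gauss3E; set y := sqnorm3 x / (2 * t ^+ 2).
have t2 : 0 < 2 * t ^+ 2 by rewrite mulr_gt0 ?exprn_gt0.
have y0 : 0 <= y by rewrite divr_ge0 ?sqnorm3_ge0 ?ltW.
have -> : sqnorm3 x = 2 * t ^+ 2 * y by rewrite /y mulrC divfK// gt_eqF.
have e0 := expR_gt0 (- y).
suff : y ^+ 2 * expR (- y) <= 4.
  move=> h; have t4 : 0 < t ^+ 4 * expR (- y) by rewrite mulr_gt0// exprn_gt0.
  have := ler_wpM2r (ltW t4) h.
  rewrite (_ : (2 * t ^+ 2 * y) ^+ 2 * expR (- y) ^+ 2 =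
    4 * (y ^+ 2 * expR (- y) * (t ^+ 4 * expR (- y)))); last by ring.
  by lra.
rewrite expRN ler_pdivrMr ?expR_gt0//.
have -> : expR y = expR (y / 2) ^+ 2 by rewrite expr2 -expRD; congr expR; field.
have := expR_ge1Dx (y / 2); nra.
Qed.

Variables (m b : R).
Hypotheses (m0 : 0 < m) (b0 : 0 < b).
Local Notation w := (mixweight m).
Local Notation tau := (width b).
Local Notation mixk := (mixkernel m b).
Local Notation N := (@gauss3_const R).

Definition widthVX (k : R) n (s : R) : R := k * (tau s)^-1 ^+ n.

Lemma measurable_widthVX k n : measurable_fun setT (widthVX k n).
Proof. by apply: measurable_funM => //; apply: measurable_funX; exact: measurable_widthV. Qed.

Lemma norm_widthVX_le k n s : `|widthVX k n s| <= `|k| * b^-1 ^+ n.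
Proof.
rewrite normrM ler_wpM2l// ger0_norm; first exact: widthVX_le.
by rewrite ltW// widthVX_gt0.
Qed.

(** The exponents are forced by the transforms: those of [gauss3 tau] and [x_j * gauss3 tau] carry
    [tau^3] and [tau^5]. They are cancelled by the [tau^-3] of the kernel, together with the weight
    [widthVX 1 0 = 1] here and [widthVX 1 2 = tau^-2] in [Bmix]. *)
Definition Amix x : R := \int[leb1]_s mixk 1 (widthVX 1 0) (x, s).
Definition Bmix x : R := \int[leb1]_s mixk 1 (widthVX 1 2) (x, s).

(** The two terms are, up to [gauss3_const], the inverse transforms of the damping and of the
    damping times [m / E]. In [Bcoef] the factor [m^-1] comes from
    [p_j / E = m^-1 * p_j * (m / E)]. *)
Definition Acoef x : R := b^-1 ^+ 3 * gauss3 b x + Amix x.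
Definition Bcoef x : R := m^-1 * Bmix x.

Lemma integrable_Acoef : (leb3 R).-integrable setT (EFin \o Acoef).
Proof.
apply: integrable_fun_add.
  by apply: integrable_fun_mulr; exact: integrable_gauss3.
apply: (integrable_Rintegral_mixkernel m0 b0 ltr01 (measurable_widthVX 1 0)).
exact: norm_widthVX_le.
Qed.

(** This splitting is the reason for the width [sqrt(b^2 + s^2)]: the damping times the Gaussian
    indexed by [s] is a single Gaussian, and the damping leaves the mean over [s]. *)
Lemma widthV_exp (q s : R) :
  expR (- (tau s ^+ 2 * q / 2)) = expR (- (b ^+ 2 * q / 2)) * expR (- (s ^+ 2 * q / 2)).
Proof. by rewrite -expRD width_sqr; congr expR; field. Qed.

Lemma integrable_mixweight_expR (q : R) : 0 <= q ->
  leb1.-integrable setT (EFin \o (fun s => w s * expR (- (s ^+ 2 * q / 2)))).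
Proof.
move=> q0; apply: (@integrable_mixweight_bounded _ _ m0 _ 1).
  apply: measurableT_comp => //; apply: measurableT_comp => //.
  by do 2 apply: measurable_funM => //.
move=> s; rewrite gtr0_norm ?expR_gt0// expR_le1 oppr_le0.
by rewrite divr_ge0// mulr_ge0// sqr_ge0.
Qed.

(** For each [s] the transform is the damping times [exp(- s^2 p^2 / 2)]; its mean over [s] is the
    damping times [m / E] by [laplace_mixweight]. *)
Lemma Acoef_fourier (c : R) (p : R3 R) :
  \int[leb3 R]_x (Acoef x * cos (c + dot3 p x)) =
  N * expR (- (b ^+ 2 * sqnorm3 p / 2)) * (1 + m / energy m p) * cos c.
Proof.
have mphi : measurable_fun setT (fun x => c + dot3 p x).
  by apply: measurable_funD => //; exact: measurable_dot3.
under eq_Rintegral do rewrite /Acoef mulrDl.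
rewrite RintegralD//; last 2 first.
- apply: integrable_mul_cos => //; apply: integrable_fun_mulr.
  exact: integrable_gauss3.
- apply: integrable_mul_cos => //.
  apply: (integrable_Rintegral_mixkernel m0 b0 ltr01 (measurable_widthVX 1 0)).
  exact: norm_widthVX_le.
under eq_Rintegral do rewrite -mulrA.
rewrite RintegralZl//; last by apply: integrable_mul_cos => //; exact: integrable_gauss3.
rewrite gauss3_fourier//.
pose a s := w s * expR (- (s ^+ 2 * sqnorm3 p / 2)).
have q0 := sqnorm3_ge0 p.
have ia := integrable_mixweight_expR q0.
have i1 s : (leb3 R).-integrable setT (EFin \o (fun x => mixk 1 (widthVX 1 0) (x, s))).
  exact: integrable_mixkernel1.
have := @cos_phase_mix R _ _ _ _ (leb3 R) leb1 (mixk 1 (widthVX 1 0)) (dot3 p)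
  (fun s => N * expR (- (b ^+ 2 * sqnorm3 p / 2)) * a s) 0 (measurable_dot3 p)
  (integrable_mixkernel m0 b0 ltr01 (measurable_widthVX 1 0) (norm_widthVX_le 1 0))
  (integrable_mixkernel2 m0 b0 ltr01 (measurable_widthVX 1 0) (norm_widthVX_le 1 0))
  i1
  (integrable_fun_mulr _ ia).
move=> /(_ _ c) ->.
  rewrite RintegralZl// laplace_mixweight// -/(energy m p) addr0.
  by field; rewrite !gt_eqF// sqrtr_gt0 ltr_wpDl ?exprn_gt0.
move=> s d; have ts := width_gt0 b0 s.
have E x : mixk 1 (widthVX 1 0) (x, s) * cos (d + dot3 p x) =
    w s * (tau s)^-1 ^+ 3 * (gauss3 (tau s) x * cos (d + dot3 p x)).
  by rewrite /mixkernel /widthVX /= !mul1r; ring.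
under eq_Rintegral do rewrite E.
rewrite RintegralZl//; last first.
  apply: integrable_mul_cos; last exact: integrable_gauss3.
  by apply: measurable_funD => //; exact: measurable_dot3.
rewrite gauss3_fourier// /a addr0 widthV_exp exprVn; field.
by rewrite gt_eqF.
Qed.

End kernels.

(** * The transform of the vector part [x_j B] *)

Section vector_kernel.
Context {R : realType}.
Local Notation leb1 := (@lebesgue_measure R).
Variables (m b : R).
Hypotheses (m0 : 0 < m) (b0 : 0 < b).
Local Notation w := (mixweight m).
Local Notation tau := (width b).
Local Notation mixk := (mixkernel m b).
Local Notation wVX := (widthVX b).
Local Notation N := (@gauss3_const R).

Let xmixk (j : 'I_3) (z : R3 R * measurableTypeR R) : R :=
  Defs.coord z.1 j * mixk 1 (wVX 1 2) z.

Let mk : measurable_fun setT (mixk 1 (wVX 1 2)).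
Proof. by apply: measurable_mixkernel => //; exact: measurable_widthVX. Qed.

Let mxmixk j : measurable_fun setT (xmixk j).
Proof.
apply: measurable_funM mk.
exact: measurableT_comp (measurable_coord j) measurable_fst.
Qed.

(* One factor |x_j| is absorbed by doubling the width of the Gaussian. *)
Let xmixk_le j z : `|xmixk j z| <= mixk 2 (wVX 2 1) z.
Proof.
case: z => x s; rewrite /xmixk /mixkernel /widthVX /= !mul1r.
have ts := width_gt0 b0 s; have ws := mixweight_gt0 m0 s.
have t5 : 0 < (tau s)^-1 ^+ 2 * (tau s)^-1 ^+ 3 by rewrite mulr_gt0// exprn_gt0// invr_gt0.
have h := ler_wpM2l (ltW (mulr_gt0 ws t5)) (norm_coord_gauss3_le x j ts).
rewrite normrM [X in _ * X]gtr0_norm; last first.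
  by rewrite mulr_gt0// mulrA mulr_gt0// gauss3_gt0.
have -> : w s * (2 * (tau s)^-1 ^+ 1 * ((tau s)^-1 ^+ 3 * gauss3 (2 * tau s) x)) =
  w s * ((tau s)^-1 ^+ 2 * (tau s)^-1 ^+ 3) * (2 * tau s * gauss3 (2 * tau s) x).
  by field; rewrite gt_eqF.
by rewrite (le_trans _ h)// le_eqVlt; apply/orP; left; apply/eqP; ring.
Qed.

Let xmixk_prod j : (leb3 R \x leb1)%E.-integrable setT (EFin \o xmixk j).
Proof.
apply: (@le_integrable_fun R _ _ (leb3 R \x leb1)%E (xmixk j) (mixk 2 (wVX 2 1))) => //.
by apply: integrable_mixkernel => //; [exact: measurable_widthVX|exact: norm_widthVX_le].
Qed.

Let xmixk1 j s : (leb3 R).-integrable setT (EFin \o (fun x => xmixk j (x, s))).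
Proof.
apply: (@le_integrable_fun R _ _ (leb3 R) _ (fun x => mixk 2 (wVX 2 1) (x, s))) => //.
- exact: measurableT_comp (mxmixk j) (pair2_measurable s).
- exact: integrable_mixkernel1.
Qed.

Let xmixk2 j x : leb1.-integrable setT (EFin \o (fun s => xmixk j (x, s))).
Proof.
apply: (@le_integrable_fun R _ _ leb1 _ (fun s => mixk 2 (wVX 2 1) (x, s))) => //.
- exact: measurableT_comp (mxmixk j) (pair1_measurable x).
- by apply: integrable_mixkernel2 => //; [exact: measurable_widthVX|exact: norm_widthVX_le].
Qed.

Let coord_BmixE j x : Defs.coord x j * Bmix m b x = \int[leb1]_s xmixk j (x, s).
Proof.
rewrite /Bmix -RintegralZl//.
by apply: integrable_mixkernel2 => //; [exact: measurable_widthVX|exact: norm_widthVX_le].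
Qed.

Lemma integrable_Bmix : (leb3 R).-integrable setT (EFin \o Bmix m b).
Proof.
apply: integrable_Rintegral_mixkernel => //; [exact: measurable_widthVX|exact: norm_widthVX_le].
Qed.

Lemma coord_BcoefE j x : Defs.coord x j * Bcoef m b x = m^-1 * (Defs.coord x j * Bmix m b x).
Proof. by rewrite /Bcoef mulrCA. Qed.

Lemma integrable_coord_Bcoef j :
  (leb3 R).-integrable setT (EFin \o (fun x => Defs.coord x j * Bcoef m b x)).
Proof.
rewrite (funext (coord_BcoefE j)) (funext (fun x => congr1 _ (coord_BmixE j x))).
apply: integrable_fun_mulr.
by apply: (integrable_mix (m1 := leb3 R) (m2 := leb1)).
Qed.

(** Same mixture argument as for [Acoef], with a factor [p_j] and the common phase [pi / 2]
    contributed by each Gaussian. *)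
Lemma coord_Bcoef_fourier j (c : R) (p : R3 R) :
  \int[leb3 R]_x (Defs.coord x j * Bcoef m b x * cos (c + dot3 p x)) =
  N * expR (- (b ^+ 2 * sqnorm3 p / 2)) * (Defs.coord p j / energy m p) *
  cos (c + pi / 2).
Proof.
have mphi d : measurable_fun setT (fun x => d + dot3 p x).
  by apply: measurable_funD => //; exact: measurable_dot3.
have E x : Defs.coord x j * Bcoef m b x * cos (c + dot3 p x) =
  m^-1 * ((\int[leb1]_s xmixk j (x, s)) * cos (c + dot3 p x)).
  by rewrite coord_BcoefE coord_BmixE -mulrA.
under eq_Rintegral do rewrite E.
rewrite RintegralZl//; last first.
  by apply: integrable_mul_cos => //; apply: (integrable_mix (m1 := leb3 R) (m2 := leb1)).
pose a s := w s * expR (- (s ^+ 2 * sqnorm3 p / 2)).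
have q0 := sqnorm3_ge0 p.
have ia := integrable_mixweight_expR m0 q0.
have := @cos_phase_mix R _ _ _ _ (leb3 R) leb1 (xmixk j) (dot3 p)
  (fun s => N * Defs.coord p j * expR (- (b ^+ 2 * sqnorm3 p / 2)) * a s)
  (pi / 2) (measurable_dot3 p) (xmixk_prod j) (xmixk2 j) (xmixk1 j)
  (integrable_fun_mulr _ ia).
move=> /(_ _ c) ->.
  rewrite RintegralZl// laplace_mixweight// -/(energy m p).
  by field; rewrite !gt_eqF// sqrtr_gt0 ltr_wpDl ?exprn_gt0.
move=> s d; have ts := width_gt0 b0 s.
have E2 x : xmixk j (x, s) * cos (d + dot3 p x) =
    w s * (tau s)^-1 ^+ 5 * (Defs.coord x j * gauss3 (tau s) x * cos (d + dot3 p x)).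
  by rewrite /xmixk /mixkernel /widthVX /= !mul1r; ring.
under eq_Rintegral do rewrite E2.
rewrite RintegralZl//; last first.
  apply: integrable_mul_cos => //.
  apply: (@le_integrable_fun R _ _ (leb3 R) (fun x => Defs.coord x j * gauss3 (tau s) x)
    (fun x => 2 * tau s * gauss3 (2 * tau s) x)).
  - apply: measurable_funM; first exact: measurable_coord.
    by apply/measurable_EFinP; apply: measurable_int (integrable_gauss3 ts).
  - move=> x; rewrite normrM (gtr0_norm (gauss3_gt0 _ _)).
    exact: norm_coord_gauss3_le.
  - by apply: integrable_fun_mulr; apply: integrable_gauss3; rewrite mulr_gt0.
rewrite coord_gauss3_fourier// /a widthV_exp exprVn; field.
by rewrite gt_eqF.
Qed.

End vector_kernel.

(** * Bounds on the norm and the second moment, and the choice of [b] *)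

Section spread.
Context {R : realType}.
Local Notation leb1 := (@lebesgue_measure R).
Local Notation N := (@gauss3_const R).

Section bounds.
Variables (m b : R).
Hypotheses (m0 : 0 < m) (b0 : 0 < b).
Local Notation w := (mixweight m).
Local Notation tau := (width b).
Local Notation mixk := (mixkernel m b).
Local Notation wVX := (widthVX b).

Definition kerdens (x : R3 R) : R := Acoef m b x ^+ 2 + sqnorm3 x * Bcoef m b x ^+ 2.

Lemma measurable_Acoef : measurable_fun setT (Acoef m b).
Proof. by apply/measurable_EFinP; apply: measurable_int (integrable_Acoef m0 b0). Qed.

Lemma measurable_Bcoef : measurable_fun setT (Bcoef m b).
Proof.
apply: measurable_funM => //.
by apply/measurable_EFinP; apply: measurable_int (integrable_Bmix m0 b0).
Qed.

Lemma measurable_kerdens : measurable_fun setT kerdens.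
Proof.
apply: measurable_funD; first by apply: measurable_funX; exact: measurable_Acoef.
apply: measurable_funM; first exact: measurable_sqnorm3.
by apply: measurable_funX; exact: measurable_Bcoef.
Qed.

Lemma kerdens_ge0 x : 0 <= kerdens x.
Proof. by rewrite addr_ge0 ?sqr_ge0// mulr_ge0 ?sqr_ge0 ?sqnorm3_ge0. Qed.

Let mix (k : R) n x := \int[leb1]_s mixk 1 (wVX k n) (x, s).

Let mix_integrable k n : (leb3 R).-integrable setT (EFin \o mix k n).
Proof.
apply: integrable_Rintegral_mixkernel => //; [exact: measurable_widthVX|exact: norm_widthVX_le].
Qed.

Let mix_ge0 k n x : 0 <= k -> 0 <= mix k n x.
Proof.
move=> k0; apply: Rintegral_ge0 => s _; rewrite /mixkernel /widthVX /=.
have a1 := ltW (mixweight_gt0 m0 s); have a2 := ltW (gauss3_gt0 (1 * tau s) x).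
have a3 i := ltW (widthVX_gt0 b0 i s).
exact: mulr_ge0 a1 (mulr_ge0 (mulr_ge0 k0 (a3 _)) (mulr_ge0 (a3 _) a2)).
Qed.

(** Cauchy-Schwarz moves the square inside the mean over [s], so a pointwise bound in one width [t]
    suffices: [hK] trades the factor [y] and one of the two Gaussians for powers of [t]. The [+ 3]
    counts the powers built into [mixkernel]. *)
Let sqr_mix_le n l (K y : R) x : 0 <= y ->
  (forall t, 0 < t -> (t^-1 ^+ (n + 3)) ^+ 2 * (y * gauss3 t x ^+ 2) <=
     K * t^-1 ^+ (l + 3) * gauss3 t x) ->
  y * mix 1 n x ^+ 2 <= mix K l x.
Proof.
move=> y0 hK.
pose h s := (tau s)^-1 ^+ (n + 3) * gauss3 (tau s) x.
have mg : measurable_fun setT (fun s => gauss3 (tau s) x).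
  have := measurableT_comp (measurable_gauss3_width b0 ltr01) (pair1_measurable x).
  by apply: eq_measurable_fun => s _ /=; rewrite mul1r.
have mV k' : measurable_fun setT (fun s => (tau s)^-1 ^+ k').
  by apply: measurable_funX; exact: measurable_widthV.
have mh : measurable_fun setT h by exact: measurable_funM.
have hC s : `|h s| <= b^-1 ^+ (n + 3).
  rewrite normrM (gtr0_norm (widthVX_gt0 b0 _ _)) (gtr0_norm (gauss3_gt0 _ _)).
  rewrite -[leRHS]mulr1 ler_pM ?widthVX_le ?gauss3_le1//.
    by rewrite ltW// widthVX_gt0.
  by rewrite ltW// gauss3_gt0.
have -> : mix 1 n x = \int[leb1]_s (w s * h s).
  apply: eq_Rintegral => s _; rewrite /mixkernel /widthVX /h /= !mul1r exprD; ring.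
have h2C s : `|h s ^+ 2| <= (b^-1 ^+ (n + 3)) ^+ 2.
  by rewrite normrX lerXn2r// nnegrE (le_trans _ (hC s)).
have mh2 : measurable_fun setT (fun s => h s ^+ 2) by exact: measurable_funX.
have i2 := integrable_mixweight_bounded m0 mh2 h2C.
apply: (le_trans (ler_wpM2l y0 (sqr_Rintegral_mixweight_le m0 mh hC))).
rewrite -RintegralZl//; apply: le_Rintegral => //.
- exact: integrable_fun_mulr.
- by apply: integrable_mixkernel2 => //; [exact: measurable_widthVX|exact: norm_widthVX_le].
move=> s _; have ts := width_gt0 b0 s.
have := ler_wpM2l (ltW (mixweight_gt0 m0 s)) (hK _ ts).
rewrite /h /mixkernel /widthVX /= mul1r exprD => H.
apply: (le_trans _ (le_trans H _)); rewrite le_eqVlt; apply/orP; left; apply/eqP.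
  by ring.
by rewrite exprD; ring.
Qed.

Let sqrD_le (a c : R) : (a + c) ^+ 2 <= 2 * a ^+ 2 + 2 * c ^+ 2.
Proof. by have := sqr_ge0 (a - c); rewrite -subr_ge0; nra. Qed.

Let mix_scale (k c : R) n x : mix (c * k) n x = c * mix k n x.
Proof.
rewrite /mix -RintegralZl//.
  by apply: eq_Rintegral => s _; rewrite /mixkernel /widthVX /=; ring.
by apply: integrable_mixkernel2 => //; [exact: measurable_widthVX|exact: norm_widthVX_le].
Qed.

(** Serves integrability only. In the mixture terms, [tau^-6] from A is kept, giving index 3, and
    [tau^-10] from B loses [tau^2] to [|x|^2], giving index 5. *)
Lemma kerdens_le x :
  kerdens x <= 2 * b^-1 ^+ 6 * gauss3 b x + (mix 2 3 x + mix (2 * m^-1 ^+ 2) 5 x).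
Proof.
have hA : mix 1 0 x ^+ 2 <= mix 1 3 x.
  rewrite -[leLHS]mul1r; apply: sqr_mix_le => // t t0.
  rewrite !mul1r -exprM ler_wpM2l ?gauss3_sqr_le// exprn_ge0// invr_ge0 ltW//.
have hB : sqnorm3 x * mix 1 2 x ^+ 2 <= mix 2 5 x.
  apply: (sqr_mix_le (sqnorm3_ge0 x)) => t t0.
  have t8 : 0 <= t^-1 ^+ 10 by rewrite exprn_ge0// invr_ge0 ltW.
  have := ler_wpM2l t8 (sqnorm3_gauss3_sqr_le x t0).
  rewrite -exprM [X in _ <= X -> _](_ : _ = 2 * t^-1 ^+ 8 * gauss3 t x)//.
  by rewrite !exprVn; field; rewrite gt_eqF.
have b6 : 0 <= b^-1 ^+ 6 by rewrite exprn_ge0// invr_ge0 ltW.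
have h2 := ler_wpM2l b6 (gauss3_sqr_le b x).
have h3 := ler_wpM2l (sqr_ge0 m^-1) hB.
have h1 := sqrD_le (b^-1 ^+ 3 * gauss3 b x) (mix 1 0 x).
have e1 : (b^-1 ^+ 3 * gauss3 b x) ^+ 2 = b^-1 ^+ 6 * gauss3 b x ^+ 2.
  by rewrite exprMn -exprM.
have e2 : sqnorm3 x * (m^-1 * mix 1 2 x) ^+ 2 =
    m^-1 ^+ 2 * (sqnorm3 x * mix 1 2 x ^+ 2) by ring.
have e3 : mix (2 * m^-1 ^+ 2) 5 x = m^-1 ^+ 2 * mix 2 5 x by rewrite mulrC mix_scale.
have e4 : mix 2 3 x = 2 * mix 1 3 x by rewrite -mix_scale mulr1.
rewrite /kerdens /Acoef /Bcoef /Amix /Bmix -/(mix 1 0 x) -/(mix 1 2 x) e2 e3 e4.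
rewrite e1 in h1.
lra.
Qed.

(** The quantitative bound. In the mixture terms, [|x|^2] lowers [tau^-6] to [tau^-4], index 1, and
    [|x|^4] lowers [tau^-10] to [tau^-6], index 3. The cross term in the square of [Acoef] costs a
    factor 2, hence the two constants 4. *)
Lemma sqnorm3_kerdens_le x :
  sqnorm3 x * kerdens x <=
  4 * b^-1 ^+ 4 * gauss3 b x + (mix 4 1 x + mix (16 * m^-1 ^+ 2) 3 x).
Proof.
have hA : sqnorm3 x * mix 1 0 x ^+ 2 <= mix 2 1 x.
  apply: (sqr_mix_le (sqnorm3_ge0 x)) => t t0.
  have t8 : 0 <= t^-1 ^+ 6 by rewrite exprn_ge0// invr_ge0 ltW.
  have := ler_wpM2l t8 (sqnorm3_gauss3_sqr_le x t0).
  rewrite -exprM [X in _ <= X -> _](_ : _ = 2 * t^-1 ^+ 4 * gauss3 t x)//.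
  by rewrite !exprVn; field; rewrite gt_eqF.
have hB : sqnorm3 x ^+ 2 * mix 1 2 x ^+ 2 <= mix 16 3 x.
  apply: (sqr_mix_le (sqr_ge0 (sqnorm3 x))) => t t0.
  have t8 : 0 <= t^-1 ^+ 10 by rewrite exprn_ge0// invr_ge0 ltW.
  have := ler_wpM2l t8 (sqnorm3_sqr_gauss3_sqr_le x t0).
  rewrite -exprM [X in _ <= X -> _](_ : _ = 16 * t^-1 ^+ 6 * gauss3 t x)//.
  by rewrite !exprVn; field; rewrite gt_eqF.
have b6 : 0 <= b^-1 ^+ 6 by rewrite exprn_ge0// invr_ge0 ltW.
have h2 := ler_wpM2l b6 (sqnorm3_gauss3_sqr_le x b0).
rewrite (_ : b^-1 ^+ 6 * (2 * b ^+ 2 * gauss3 b x) = 2 * b^-1 ^+ 4 * gauss3 b x) in h2; last first.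
  by rewrite !exprVn; field; rewrite gt_eqF.
have h3 := ler_wpM2l (sqr_ge0 m^-1) hB.
have h1 := ler_wpM2l (sqnorm3_ge0 x) (sqrD_le (b^-1 ^+ 3 * gauss3 b x) (mix 1 0 x)).
have e1 : sqnorm3 x * (2 * (b^-1 ^+ 3 * gauss3 b x) ^+ 2 + 2 * mix 1 0 x ^+ 2) =
    2 * (b^-1 ^+ 6 * (sqnorm3 x * gauss3 b x ^+ 2)) + 2 * (sqnorm3 x * mix 1 0 x ^+ 2).
  by ring.
have e2 : sqnorm3 x * ((b^-1 ^+ 3 * gauss3 b x + mix 1 0 x) ^+ 2 +
      sqnorm3 x * (m^-1 * mix 1 2 x) ^+ 2) =
    sqnorm3 x * (b^-1 ^+ 3 * gauss3 b x + mix 1 0 x) ^+ 2 +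
    m^-1 ^+ 2 * (sqnorm3 x ^+ 2 * mix 1 2 x ^+ 2) by ring.
have e3 : mix (16 * m^-1 ^+ 2) 3 x = m^-1 ^+ 2 * mix 16 3 x by rewrite mulrC mix_scale.
have e4 : mix 4 1 x = 2 * mix 2 1 x by rewrite -mix_scale; congr mix; ring.
rewrite /kerdens /Acoef /Bcoef /Amix /Bmix -/(mix 1 0 x) -/(mix 1 2 x) e2 e3 e4.
rewrite e1 in h1.
lra.
Qed.

Let gauss_integrable (k : R) : (leb3 R).-integrable setT (EFin \o (fun x => k * gauss3 b x)).
Proof. by apply: integrable_fun_mulr; exact: integrable_gauss3. Qed.

Lemma integrable_kerdens : (leb3 R).-integrable setT (EFin \o kerdens).
Proof.
apply: (@le_integrable_fun R _ _ (leb3 R) kerdens (fun x => 2 * b^-1 ^+ 6 * gauss3 b x +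
  (mix 2 3 x + mix (2 * m^-1 ^+ 2) 5 x))); first exact: measurable_kerdens.
- by move=> x; rewrite ger0_norm ?kerdens_ge0//; exact: kerdens_le.
- apply: integrable_fun_add; first exact: gauss_integrable.
  by apply: integrable_fun_add; exact: mix_integrable.
Qed.

Lemma integrable_sqnorm3_kerdens :
  (leb3 R).-integrable setT (EFin \o (fun x => sqnorm3 x * kerdens x)).
Proof.
apply: (@le_integrable_fun R _ _ (leb3 R) (fun x => sqnorm3 x * kerdens x)
  (fun x => 4 * b^-1 ^+ 4 * gauss3 b x + (mix 4 1 x + mix (16 * m^-1 ^+ 2) 3 x))).
- by apply: measurable_funM; [exact: measurable_sqnorm3|exact: measurable_kerdens].
- move=> x; rewrite ger0_norm ?mulr_ge0 ?kerdens_ge0 ?sqnorm3_ge0//.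
  exact: sqnorm3_kerdens_le.
- apply: integrable_fun_add; first exact: gauss_integrable.
  by apply: integrable_fun_add; exact: mix_integrable.
Qed.

(** Since [Amix] is nonnegative, only [b^-3 * gauss3 b] is kept. Its square has width [b / sqrt 2];
    the smaller width [b / 2] avoids the root and yields the mass [(b / 2)^3], whence the 8. *)
Lemma Rintegral_kerdens_ge : N * b^-1 ^+ 3 / 8 <= \int[leb3 R]_x kerdens x.
Proof.
have b2 : 0 < b / 2 by rewrite divr_gt0.
have -> : N * b^-1 ^+ 3 / 8 = \int[leb3 R]_x (b^-1 ^+ 6 * gauss3 (b / 2) x).
  rewrite RintegralZl//; last exact: integrable_gauss3.
  by rewrite Rintegral_gauss3// !exprVn; field; rewrite gt_eqF.
apply: le_Rintegral => //.
- by apply: integrable_fun_mulr; exact: integrable_gauss3.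
- exact: integrable_kerdens.
move=> x _; apply: (@le_trans _ _ (Acoef m b x ^+ 2)); last first.
  by rewrite lerDl mulr_ge0 ?sqr_ge0 ?sqnorm3_ge0.
apply: (@le_trans _ _ ((b^-1 ^+ 3 * gauss3 b x) ^+ 2)); last first.
  have p0 : 0 <= b^-1 ^+ 3 * gauss3 b x.
    by rewrite mulr_ge0 ?(ltW (gauss3_gt0 _ _))// exprn_ge0// invr_ge0 ltW.
  rewrite lerXn2r// ?nnegrE /Acoef ?lerDl; first by apply: addr_ge0 => //; exact: mix_ge0.
  exact: mix_ge0.
rewrite exprMn -exprM ler_wpM2l// ?exprn_ge0 ?invr_ge0 ?(ltW b0)//.
rewrite !gauss3E [leRHS]expr2 -expRD ler_expR -opprD lerN2 -subr_ge0.
rewrite (_ : _ - _ = sqnorm3 x * b^-1 ^+ 2); first by rewrite mulr_ge0 ?sqnorm3_ge0 ?sqr_ge0.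
by rewrite exprVn; field; rewrite gt_eqF.
Qed.

(** Here [(b / tau)^3 <= (b / tau)^2], and the range of [s] is cut at [s^2 = b]. Below the cut the
    exponential is at least 1/2; above it [b^2 / (b^2 + s^2)] is less than [b]. An exponential is
    used instead of an indicator so that its mean is given by [laplace_mixweight]. *)
Let widthV3_le s : (tau s)^-1 ^+ 3 <= b^-1 ^+ 3 * (2 * expR (- (s ^+ 2 * b^-1 / 2)) + b).
Proof.
have t0 := width_gt0 b0 s; have b2 : 0 < b ^+ 2 by rewrite exprn_gt0.
have e0 := expR_gt0 (- (s ^+ 2 * b^-1 / 2)).
suff K : b ^+ 2 * (tau s)^-1 ^+ 2 <= 2 * expR (- (s ^+ 2 * b^-1 / 2)) + b.
  have tb : (tau s)^-1 <= b^-1 by rewrite lef_pV2 ?posrE ?width_ge.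
  have p0 : 0 <= (tau s)^-1 ^+ 2 by rewrite exprn_ge0// invr_ge0 ltW.
  apply: (@le_trans _ _ (b^-1 * (tau s)^-1 ^+ 2)).
    by rewrite exprS ler_wpM2r.
  have b3 : 0 <= b^-1 ^+ 3 by rewrite exprn_ge0// invr_ge0 ltW.
  have := ler_wpM2l b3 K.
  by rewrite (_ : _ * (b ^+ 2 * _) = b^-1 * (tau s)^-1 ^+ 2)//;
    rewrite exprVn; field; rewrite !gt_eqF.
rewrite exprVn ler_pdivrMr ?exprn_gt0// width_sqr.
have [sb|sb] := leP (s ^+ 2) b.
  have : 1 <= 2 * expR (- (s ^+ 2 * b^-1 / 2)).
    have := expR_ge1Dx (- (s ^+ 2 * b^-1 / 2)).
    have : s ^+ 2 * b^-1 <= 1 by rewrite ler_pdivrMr// mul1r.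
    lra.
  have := sqr_ge0 s; nra.
have := ltW b0; nra.
Qed.

(** The term [8 * b^-1] collects [4 * b^-1] from the pure Gaussian and [4 * b^-1] from the index 1
    mixture, where [tau^-1 <= b^-1]. The rest is the index 3 mixture, whose mean of [tau^-3] is
    bounded by [widthV3_le]. *)
Lemma Rintegral_sqnorm3_kerdens_le :
  \int[leb3 R]_x (sqnorm3 x * kerdens x) <=
  N * (8 * b^-1 + 16 * m^-1 ^+ 2 * b^-1 ^+ 3 * (2 * (m / Num.sqrt (b^-1 + m ^+ 2)) + b)).
Proof.
have mixE k n : \int[leb3 R]_x mix k n x = N * \int[leb1]_s (w s * wVX k n s).
  rewrite (Rintegral_mixkernel m0 b0 ltr01 (measurable_widthVX b0 k n)
    (norm_widthVX_le b0 k n)).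
  by rewrite expr1n mul1r.
apply: (@le_trans _ _ (\int[leb3 R]_x (4 * b^-1 ^+ 4 * gauss3 b x +
   (mix 4 1 x + mix (16 * m^-1 ^+ 2) 3 x)))).
  apply: le_Rintegral => //.
  - exact: integrable_sqnorm3_kerdens.
  - apply: integrable_fun_add; first exact: gauss_integrable.
  by apply: integrable_fun_add; exact: mix_integrable.
  - by move=> x _; exact: sqnorm3_kerdens_le.
rewrite RintegralD//; last by apply: integrable_fun_add; exact: mix_integrable.
rewrite RintegralD//; try exact: mix_integrable.
rewrite RintegralZl//; last exact: integrable_gauss3.
rewrite Rintegral_gauss3// !mixE.
have iw := integrable_mixweight m0.
have h1 : \int[leb1]_s (w s * wVX 4 1 s) <= 4 * b^-1.
  have -> : 4 * b^-1 = \int[leb1]_s (4 * b^-1 * w s).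
    by rewrite (@RintegralZl _ _ _ leb1 setT (mixweight m))// Rintegral_mixweight// mulr1.
  apply: le_Rintegral => //.
  - apply: (integrable_mixweight_bounded m0); first exact: measurable_widthVX.
    exact: norm_widthVX_le.
  - exact: integrable_fun_mulr.
  - move=> s _; rewrite mulrC ler_wpM2r ?(ltW (mixweight_gt0 m0 _))//.
    by rewrite /widthVX ler_wpM2l//; exact: (widthVX_le b0 1).
have bV0 : 0 <= b^-1 by rewrite invr_ge0 ltW.
have iL := integrable_mixweight_expR m0 bV0.
have h2 : \int[leb1]_s (w s * wVX (16 * m^-1 ^+ 2) 3 s) <=
  16 * m^-1 ^+ 2 * b^-1 ^+ 3 * (2 * (m / Num.sqrt (b^-1 + m ^+ 2)) + b).
  set c := 16 * m^-1 ^+ 2 * b^-1 ^+ 3.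
  have -> : c * (2 * (m / Num.sqrt (b^-1 + m ^+ 2)) + b) =
     \int[leb1]_s (c * 2 * (w s * expR (- (s ^+ 2 * b^-1 / 2))) + c * b * w s).
    rewrite RintegralD//; try exact: integrable_fun_mulr.
    rewrite RintegralZl// (@RintegralZl _ _ _ leb1 setT (mixweight m))//.
    by rewrite laplace_mixweight// Rintegral_mixweight//; ring.
  apply: le_Rintegral => //.
  - apply: (integrable_mixweight_bounded m0); first exact: measurable_widthVX.
    exact: norm_widthVX_le.
  - by apply: integrable_fun_add; exact: integrable_fun_mulr.
  - move=> s _; have k0 : 0 <= w s * (16 * m^-1 ^+ 2).
      by rewrite mulr_ge0 ?(ltW (mixweight_gt0 m0 _))// mulr_ge0// sqr_ge0.
    have := ler_wpM2l k0 (widthV3_le s); rewrite /widthVX /c.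
    by rewrite mulrA => /le_trans; apply; rewrite le_eqVlt; apply/orP; left; apply/eqP; ring.
have N0 : 0 <= N by rewrite ltW// gauss3_const_gt0.
have -> : 4 * b^-1 ^+ 4 * (b ^+ 3 * N) = N * (4 * b^-1).
  by rewrite exprVn; field; rewrite gt_eqF.
rewrite -!mulrDr ler_wpM2l//; lra.
Qed.

End bounds.

(** With [b = r^2], the quotient of the two preceding bounds is at most
    [64 r^4 + 256 r / m + 128 r^2 / m^2], which is at most [r * K] when [r <= 1]. *)
Lemma exists_small_spread (m d : R) : 0 < m -> 0 < d ->
  exists2 b, 0 < b & \int[leb3 R]_x (sqnorm3 x * kerdens m b x) <
                     d * \int[leb3 R]_x kerdens m b x.
Proof.
move=> m0 d0.
(* The coefficients are those of the second-moment bound, 8, 32 and 16, times the 8 of the norm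
   bound. *)
pose K : R := 64 + 256 / m + 128 / m ^+ 2.
have K0 : 0 < K by rewrite !addr_gt0// divr_gt0// exprn_gt0.
pose r := Num.min 1 (d / (2 * K)).
have r0 : 0 < r by rewrite lt_min ltr01 divr_gt0// mulr_gt0.
have r1 : r <= 1 by rewrite ge_min lexx.
have rK : r * K < d.
  apply: (@le_lt_trans _ _ (d / 2)); last by lra.
  rewrite -ler_pdivlMr// (_ : d / 2 / K = d / (2 * K)); first by rewrite ge_min lexx orbT.
  by field; rewrite gt_eqF.
have b0 : 0 < r ^+ 2 by rewrite exprn_gt0.
exists (r ^+ 2) => //.
apply: (le_lt_trans (Rintegral_sqnorm3_kerdens_le m0 b0)).
apply: (@lt_le_trans _ _ (d * (N * (r ^+ 2)^-1 ^+ 3 / 8))); last first.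
  by rewrite ler_wpM2l ?(ltW d0)// Rintegral_kerdens_ge.
(* Dropping [m^2] under the root leaves [m * sqrt b]; this is the slowest term and the reason for
   taking [b] to be a square. *)
have hL : m / Num.sqrt ((r ^+ 2)^-1 + m ^+ 2) <= m * r.
  rewrite ler_wpM2l ?(ltW m0)// -[leRHS]invrK lef_pV2 ?posrE ?sqrtr_gt0 ?invr_gt0//; last first.
    by rewrite addr_gt0 ?invr_gt0 ?exprn_gt0.
  rewrite -[leLHS](ger0_norm) ?invr_ge0 ?(ltW r0)// -sqrtr_sqr ler_wsqrtr//.
  by rewrite exprVn lerDl sqr_ge0.
have N0 := @gauss3_const_gt0 R.
have u0 : 0 < (r ^+ 2)^-1 ^+ 3 by rewrite exprn_gt0// invr_gt0.
set u := (r ^+ 2)^-1 ^+ 3 in u0 *.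
have mV : 0 < m^-1 by rewrite invr_gt0.
have c0 : 0 <= 16 * m^-1 ^+ 2 * u.
  by apply: mulr_ge0; [apply: mulr_ge0 => //; exact: sqr_ge0|exact: ltW].
apply: (@le_lt_trans _ _ (N * (8 * (r ^+ 2)^-1 + 16 * m^-1 ^+ 2 * u * (2 * (m * r) + r ^+ 2)))).
  rewrite ler_wpM2l ?(ltW N0)// lerD2l ler_wpM2l// lerD2r; lra.
have S0 : 0 < N * u / 8 by rewrite divr_gt0// mulr_gt0.
have r2 : r ^+ 2 <= r by rewrite expr2 ler_piMl// ltW.
have r4 : r ^+ 4 <= r.
  by rewrite (le_trans _ r2)// ler_wiXn2l// ltW.
have p : 64 * r ^+ 4 + 256 * (r / m) + 128 * (r ^+ 2 / m ^+ 2) <= r * K.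
  have v0 : 0 <= (m ^+ 2)^-1 by rewrite invr_ge0 sqr_ge0.
  have h := ler_wpM2r v0 r2.
  have -> : r * K = 64 * r + 256 * (r / m) + 128 * (r / m ^+ 2) by rewrite /K; ring.
  lra.
have := ler_wpM2l (ltW S0) p; have := rK; rewrite -(ltr_pM2l S0) => q1 q2.
have := le_lt_trans q2 q1.
rewrite [X in _ < X -> _](_ : _ = d * (N * u / 8)); last by ring.
apply: le_lt_trans; rewrite le_eqVlt; apply/orP; left; apply/eqP.
by rewrite /u; field; rewrite !gt_eqF.
Qed.

End spread.

(** * Complex-valued integrals and the Fourier transform by duality *)

Section complex_integral.
Local Open Scope complex_scope.
Context {R : realType}.
Implicit Types (z w : R[i]).

Definition cabs z : R := Num.sqrt (csq z).

Lemma csq_ge0 z : 0 <= csq z.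
Proof. by rewrite addr_ge0 ?sqr_ge0. Qed.

Lemma csqM z w : csq (z * w) = csq z * csq w.
Proof. by case: z => a b; case: w => c d; rewrite /csq /=; ring. Qed.

Lemma cabsM z w : cabs (z * w) = cabs z * cabs w.
Proof. by rewrite /cabs csqM sqrtrM ?csq_ge0. Qed.

Lemma cabs_conj z : cabs (conjc z) = cabs z.
Proof. by case: z => a b; rewrite /cabs /csq /= sqrrN. Qed.

Lemma cabs_expi (t : R) : cabs (expi t) = 1.
Proof. by rewrite /cabs /csq /= cos2Dsin2 sqrtr1. Qed.

Lemma Re_le_cabs z : `|complex.Re z| <= cabs z.
Proof. by rewrite -sqrtr_sqr ler_wsqrtr// lerDl sqr_ge0. Qed.

Lemma Im_le_cabs z : `|complex.Im z| <= cabs z.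
Proof. by rewrite -sqrtr_sqr ler_wsqrtr// lerDr sqr_ge0. Qed.

Lemma cabs_le z : cabs z <= `|complex.Re z| + `|complex.Im z|.
Proof.
rewrite -[leRHS]ger0_norm ?addr_ge0// -sqrtr_sqr ler_wsqrtr// /csq.
rewrite -[X in X + _ <= _](real_normK (num_real _)) -[X in _ + X <= _](real_normK (num_real _)).
by have := normr_ge0 (complex.Re z); have := normr_ge0 (complex.Im z); nra.
Qed.

Section generic.
Context d (T : measurableType d).
Implicit Types (f g : T -> R[i]).

(** Counterpart of [cmeasurable] over any measurable type; the Fubini argument needs it on
    [R3 R * R3 R]. [Cint] generalizes [cint] in the same way. *)
Definition cmfun f := measurable_fun setT (fun x => complex.Re (f x)) /\
  measurable_fun setT (fun x => complex.Im (f x)).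

Lemma cmfunM f g : cmfun f -> cmfun g -> cmfun (fun x => f x * g x).
Proof.
move=> [f1 f2] [g1 g2]; split.
  rewrite (_ : (fun x => _) = (fun x => complex.Re (f x) * complex.Re (g x) -
     complex.Im (f x) * complex.Im (g x))).
    by apply: measurable_funB; exact: measurable_funM.
  by apply/funext => x; case: (f x) => a b; case: (g x).
rewrite (_ : (fun x => _) = (fun x => complex.Re (f x) * complex.Im (g x) +
     complex.Im (f x) * complex.Re (g x))).
  by apply: measurable_funD; exact: measurable_funM.
by apply/funext => x; case: (f x) => a b; case: (g x) => ? ? /=.
Qed.

Lemma cmfunD f g : cmfun f -> cmfun g -> cmfun (fun x => f x + g x).
Proof.
move=> [f1 f2] [g1 g2]; split.
  rewrite (_ : (fun x => _) = (fun x => complex.Re (f x) + complex.Re (g x))).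
    exact: measurable_funD.
  by apply/funext => x; case: (f x) => a b; case: (g x).
rewrite (_ : (fun x => _) = (fun x => complex.Im (f x) + complex.Im (g x))).
  exact: measurable_funD.
by apply/funext => x; case: (f x) => a b; case: (g x).
Qed.

Lemma cmfun_conj f : cmfun f -> cmfun (fun x => conjc (f x)).
Proof.
move=> [f1 f2]; split.
  by rewrite (_ : (fun x => _) = (fun x => complex.Re (f x)))//;
    apply/funext => x; case: (f x).
rewrite (_ : (fun x => _) = (fun x => - complex.Im (f x))); first exact: measurableT_comp.
by apply/funext => x; case: (f x).
Qed.

Lemma cmfun_cst z : cmfun (fun=> z).
Proof. by split; exact: measurable_cst. Qed.

Lemma cmfun_real (u : T -> R) : measurable_fun setT u -> cmfun (fun x => (u x)%:C).
Proof. by move=> mu; split => //=; exact: measurable_cst. Qed.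

Lemma cmfun_expi (u : T -> R) : measurable_fun setT u -> cmfun (fun x => expi (u x)).
Proof.
move=> mu; split => /=; apply: measurableT_comp => //; apply: continuous_measurable_fun.
  exact: continuous_cos.
exact: continuous_sin.
Qed.

Variable mu : {measure set T -> \bar R}.

Definition cintegrable f := mu.-integrable setT (EFin \o (fun x => complex.Re (f x))) /\
  mu.-integrable setT (EFin \o (fun x => complex.Im (f x))).

Definition Cint f : R[i] := (\int[mu]_x (complex.Re (f x))) +i* (\int[mu]_x (complex.Im (f x))).

Lemma le_cintegrable f (g : T -> R) : cmfun f -> (forall x, cabs (f x) <= g x) ->
  mu.-integrable setT (EFin \o g) -> cintegrable f.
Proof.
move=> [f1 f2] fg gi; split; (apply: le_integrable_fun gi => // x);
  rewrite (le_trans _ (fg x)) ?Re_le_cabs ?Im_le_cabs//.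
Qed.

Lemma cintegrable_cmfun f : cintegrable f -> cmfun f.
Proof. by move=> [/measurable_int/measurable_EFinP ? /measurable_int/measurable_EFinP ?]. Qed.

Lemma measurable_cabs f : cmfun f -> measurable_fun setT (fun x => cabs (f x)).
Proof.
move=> [f1 f2].
have ms : measurable_fun setT (Num.sqrt : R -> R).
  by apply: continuous_measurable_fun; exact: sqrt_continuous.
have mc : measurable_fun setT (fun x => csq (f x)).
  by apply: measurable_funD; exact: measurable_funX.
exact: measurableT_comp ms mc.
Qed.

Lemma integrable_cabs f : cintegrable f -> mu.-integrable setT (EFin \o (fun x => cabs (f x))).
Proof.
move=> fi; have [f1 f2] := fi.
apply: (@le_integrable_fun _ _ _ _ _ (fun x => `|complex.Re (f x)| + `|complex.Im (f x)|)).
- exact/measurable_cabs/cintegrable_cmfun.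
- by move=> x; rewrite ger0_norm ?sqrtr_ge0// cabs_le.
- by apply: integrable_fun_add; exact: integrable_norm.
Qed.

Lemma CintZl f z : cintegrable f -> Cint (fun x => z * f x) = z * Cint f.
Proof.
move=> [f1 f2]; case: z => a b; rewrite /Cint.
have E1 x : complex.Re ((a +i* b) * f x) = a * complex.Re (f x) - b * complex.Im (f x).
  by case: (f x).
have E2 x : complex.Im ((a +i* b) * f x) = a * complex.Im (f x) + b * complex.Re (f x).
  by case: (f x).
under eq_Rintegral do rewrite E1.
under [X in _ +i* X]eq_Rintegral do rewrite E2.
rewrite RintegralB ?RintegralD//; try exact: integrable_fun_mulr.
by rewrite !RintegralZl.
Qed.

Lemma cintegrableZl f z : cintegrable f -> cintegrable (fun x => z * f x).
Proof.
move=> fi; apply: (@le_cintegrable _ (fun x => cabs z * cabs (f x))).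
- by apply: cmfunM; [exact: cmfun_cst|exact: cintegrable_cmfun].
- by move=> x; rewrite cabsM.
- by apply: integrable_fun_mulr; exact: integrable_cabs.
Qed.

Lemma CintD f g : cintegrable f -> cintegrable g ->
  Cint (fun x => f x + g x) = Cint f + Cint g.
Proof.
move=> [f1 f2] [g1 g2]; rewrite /Cint.
have E1 x : complex.Re (f x + g x) = complex.Re (f x) + complex.Re (g x).
  by case: (f x) => ? ?; case: (g x).
have E2 x : complex.Im (f x + g x) = complex.Im (f x) + complex.Im (g x).
  by case: (f x) => ? ?; case: (g x).
under eq_Rintegral do rewrite E1.
under [X in _ +i* X]eq_Rintegral do rewrite E2.
by rewrite !RintegralD.
Qed.

Lemma cintegrableD f g : cintegrable f -> cintegrable g ->
  cintegrable (fun x => f x + g x).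
Proof.
move=> [f1 f2] [g1 g2]; split.
  rewrite (_ : (fun x => _) = (fun x => complex.Re (f x) + complex.Re (g x))).
    exact: integrable_fun_add.
  by apply/funext => x; case: (f x) => ? ?; case: (g x).
rewrite (_ : (fun x => _) = (fun x => complex.Im (f x) + complex.Im (g x))).
  exact: integrable_fun_add.
by apply/funext => x; case: (f x) => ? ?; case: (g x).
Qed.

Lemma cintegrable_sum (I : Type) (r : seq I) (F : I -> T -> R[i]) :
  (forall i, cintegrable (F i)) -> cintegrable (fun x => \sum_(i <- r) F i x).
Proof.
move=> Fi; elim: r => [|i r ih].
  under eq_fun do rewrite big_nil; split; exact: integrable0.
by under eq_fun do rewrite big_cons; exact: cintegrableD.
Qed.

Lemma Cint_sum (I : Type) (r : seq I) (F : I -> T -> R[i]) :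
  (forall i, cintegrable (F i)) ->
  Cint (fun x => \sum_(i <- r) F i x) = \sum_(i <- r) Cint (F i).
Proof.
move=> Fi; elim: r => [|i r ih].
  rewrite big_nil; under eq_fun do rewrite big_nil.
  by rewrite /Cint /= /Rintegral integral0.
rewrite big_cons -ih; under eq_fun do rewrite big_cons.
by rewrite CintD//; exact: cintegrable_sum.
Qed.

Lemma Cint_conj f : cintegrable f -> Cint (fun x => conjc (f x)) = conjc (Cint f).
Proof.
move=> [f1 f2]; rewrite /Cint.
have E1 x : complex.Re (conjc (f x)) = complex.Re (f x) by case: (f x).
have E2 x : complex.Im (conjc (f x)) = -1 * complex.Im (f x).
  by case: (f x) => ? ?; rewrite mulN1r.
under eq_Rintegral do rewrite E1.
under [X in _ +i* X]eq_Rintegral do rewrite E2.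
by rewrite RintegralZl// mulN1r.
Qed.

Lemma cintegrable_conj f : cintegrable f -> cintegrable (fun x => conjc (f x)).
Proof.
move=> fi; have mf := cmfun_conj (cintegrable_cmfun fi).
have le x : cabs (conjc (f x)) <= cabs (f x) by rewrite cabs_conj.
exact: le_cintegrable mf le (integrable_cabs fi).
Qed.

Lemma cintegrable_expiM (u : T -> R) f : measurable_fun setT u -> cintegrable f ->
  cintegrable (fun x => expi (u x) * f x).
Proof.
move=> mu' fi; have mf := cmfunM (cmfun_expi mu') (cintegrable_cmfun fi).
have le x : cabs (expi (u x) * f x) <= cabs (f x) by rewrite cabsM cabs_expi mul1r.
exact: le_cintegrable mf le (integrable_cabs fi).
Qed.

Lemma conjc_expi (t : R) : conjc (expi t) = expi (- t).
Proof. by rewrite /expi /= cosN sinN. Qed.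

Lemma cintegrable_conj_expiM (u : T -> R) f : measurable_fun setT u -> cintegrable f ->
  cintegrable (fun x => conjc (expi (u x)) * f x).
Proof.
move=> mu' fi; under eq_fun do rewrite conjc_expi.
by apply: cintegrable_expiM => //; exact: measurableT_comp.
Qed.

End generic.

Lemma Cint_swap d1 d2 (T1 : measurableType d1) (T2 : measurableType d2)
    (m1 : {sigma_finite_measure set T1 -> \bar R})
    (m2 : {sigma_finite_measure set T2 -> \bar R}) (K : T1 * T2 -> R[i]) :
  cintegrable (m1 \x m2)%E K ->
  (forall x, cintegrable m2 (fun y => K (x, y))) ->
  (forall y, cintegrable m1 (fun x => K (x, y))) ->
  Cint m1 (fun x => Cint m2 (fun y => K (x, y))) =
  Cint m2 (fun y => Cint m1 (fun x => K (x, y))).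
Proof.
move=> [K1 K2] s2 s1; rewrite /Cint /=; congr (_ +i* _).
  rewrite -(Rintegral12_prod K1); last by move=> x; have [] := s2 x.
  by rewrite -(Rintegral21_prod K1)// => y; have [] := s1 y.
rewrite -(Rintegral12_prod K2); last by move=> x; have [] := s2 x.
by rewrite -(Rintegral21_prod K2)// => y; have [] := s1 y.
Qed.

Lemma cint_Cint (f : R3 R -> R[i]) : cint f = Cint (leb3 R) f.
Proof. by []. Qed.

Lemma measurable_dot3_prod :
  measurable_fun setT (fun z : R3 R * R3 R => dot3 z.2 z.1).
Proof.
rewrite /dot3; apply: measurable_sum => j; apply: measurable_funM.
  exact: measurableT_comp (measurable_coord j) measurable_snd.
exact: measurableT_comp (measurable_coord j) measurable_fst.
Qed.

Lemma dot3C (p x : R3 R) : dot3 p x = dot3 x p.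
Proof. by rewrite /dot3; apply: eq_bigr => j _; rewrite mulrC. Qed.

Definition FT_const : R[i] := ((Num.sqrt (2 * pi : R)) ^- 3)%:C.

(* Fubini applied to (x, p) |-> exp(i p.x) conj(f x) phi(p). *)
Lemma is_FT_pointwise (f g : R3 R -> R[i]) :
  cintegrable (leb3 R) f -> cL2 g ->
  (forall p, g p = FT_const *
     Cint (leb3 R) (fun x => conjc (expi (dot3 p x)) * f x)) ->
  is_FT f g.
Proof.
move=> fi g2 gE; split => // phi [mphi phi1] _.
set c0 := FT_const in gE *.
have mf := cintegrable_cmfun fi.
have phii : (leb3 R).-integrable setT (EFin \o (fun x => cabs (phi x))).
  apply/integrableP; split; first by apply/measurable_EFinP; exact: measurable_cabs.
  by under eq_integral do rewrite /= ger0_norm ?sqrtr_ge0//.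
have fabs := integrable_cabs fi.
pose K (z : R3 R * R3 R) := c0 * (expi (dot3 z.2 z.1) * (conjc (f z.1) * phi z.2)).
have cK (z : R3 R * R3 R) : cabs (K z) = cabs c0 * (cabs (f z.1) * cabs (phi z.2)).
  by rewrite /K !cabsM cabs_expi mul1r cabs_conj.
have phic : cintegrable (leb3 R) phi by exact: le_cintegrable mphi (fun=> lexx _) phii.
have md p : measurable_fun setT (fun x : R3 R => dot3 p x) by exact: measurable_dot3.
have md' x : measurable_fun setT (fun p : R3 R => dot3 p x).
  by under eq_fun do rewrite dot3C; exact: measurable_dot3.
have fci := cintegrable_conj fi.
have mK : cmfun K.
  have [mf1 mf2] := cmfun_conj mf; have [mp1 mp2] := mphi.
  have mf' : cmfun (fun z : R3 R * R3 R => conjc (f z.1)).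
    by split; [exact: measurableT_comp mf1 measurable_fst|
               exact: measurableT_comp mf2 measurable_fst].
  have mp' : cmfun (fun z : R3 R * R3 R => phi z.2).
    by split; [exact: measurableT_comp mp1 measurable_snd|
               exact: measurableT_comp mp2 measurable_snd].
  have me := cmfun_expi measurable_dot3_prod.
  exact: cmfunM (cmfun_cst _ c0) (cmfunM me (cmfunM mf' mp')).
have K12 : cintegrable (leb3 R \x leb3 R)%E K.
  have ip := integrable_prod (m1 := leb3 R) (m2 := leb3 R) fabs phii.
  have le (z : R3 R * R3 R) : cabs (K z) <= cabs c0 * (cabs (f z.1) * cabs (phi z.2)).
    by rewrite cK.
  exact: le_cintegrable mK le (integrable_fun_mulr (cabs c0) ip).
have K2 x : cintegrable (leb3 R) (fun p => expi (dot3 p x) * phi p).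
  exact: cintegrable_expiM (md' x) phic.
have K1 p : cintegrable (leb3 R) (fun x => expi (dot3 p x) * conjc (f x)).
  exact: cintegrable_expiM (md p) fci.
have eK2 x : (fun p => K (x, p)) = (fun p => c0 * conjc (f x) * (expi (dot3 p x) * phi p)).
  by apply/funext => p; rewrite /K /=; ring.
have eK1 p : (fun x => K (x, p)) = (fun x => c0 * phi p * (expi (dot3 p x) * conjc (f x))).
  by apply/funext => x; rewrite /K /=; ring.
have := Cint_swap (m1 := leb3 R) (m2 := leb3 R) K12.
have s2 x : cintegrable (leb3 R) (fun p => K (x, p)).
  by rewrite eK2; exact: cintegrableZl.
have s1 p : cintegrable (leb3 R) (fun x => K (x, p)).
  by rewrite eK1; exact: cintegrableZl.
move=> /(_ s2 s1) H.
transitivity (Cint (leb3 R) (fun p => Cint (leb3 R) (fun x => K (x, p)))).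
  rewrite cint_Cint; congr Cint; apply/funext => p.
  have i1 := cintegrable_conj_expiM (md p) fi.
  have e1 x : conjc (conjc (expi (dot3 p x)) * f x) = expi (dot3 p x) * conjc (f x).
    by case: (expi _) => a b; case: (f x) => k l; apply/eqP;
      rewrite eq_complex /=; apply/andP; split; apply/eqP; ring.
  have e2 : conjc c0 = c0 by rewrite /c0 /FT_const /= oppr0.
  have e3 : conjc (g p) = c0 * Cint (leb3 R) (fun x => expi (dot3 p x) * conjc (f x)).
    by rewrite gE -(funext e1) (Cint_conj i1) -[in RHS]e2 -rmorphM.
  by rewrite eK1 (CintZl (c0 * phi p) (K1 p)) e3 mulrAC.
rewrite -H cint_Cint; congr Cint; apply/funext => x.
by rewrite eK2 (CintZl (c0 * conjc (f x)) (K2 x)) /invFT mulrA (mulrC _ c0).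
Qed.

End complex_integral.

(** * Algebra of the Dirac matrices *)

Section dirac_algebra.
Local Open Scope complex_scope.
Context {R : realType}.
Variables (alpha : 'I_3 -> 'M[R[i]]_4) (beta : 'M[R[i]]_4).
Hypothesis dirac : dirac_matrices alpha beta.
Local Notation C := (R[i]).

Definition sigma_mx (x : R3 R) : 'M[C]_4 := \sum_(j < 3) (Defs.coord x j)%:C *: alpha j.

(** Twice the square is symmetrized by exchanging the two summation indices, which makes the
    anticommutators appear; only the diagonal ones survive. *)
Lemma sigma_mx_sqr x : sigma_mx x * sigma_mx x = ((sqnorm3 x)%:C)%:M.
Proof.
have [_ _ aa _ _] := dirac.
have two : (2 : C) != 0 by rewrite pnatr_eq0.
apply: (scalerI two); rewrite [LHS]scaler_nat mulr2n.
have E : sigma_mx x * sigma_mx x = \sum_(j < 3) \sum_(k < 3)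
    ((Defs.coord x j)%:C * (Defs.coord x k)%:C) *: (alpha j * alpha k).
  rewrite /sigma_mx mulr_suml; apply: eq_bigr => j _.
  by rewrite mulr_sumr; apply: eq_bigr => k _; rewrite -scalerAl -scalerAr scalerA.
rewrite [X in X + _]E [X in _ + X]E [X in _ + X]exchange_big -big_split /=.
have -> : (sqnorm3 x)%:C = \sum_(j < 3) (Defs.coord x j)%:C * (Defs.coord x j)%:C :> C.
  by rewrite /sqnorm3 /dot3 rmorph_sum; apply: eq_bigr => j _; rewrite rmorphM.
rewrite raddf_sum scaler_sumr; apply: eq_bigr => j _.
rewrite -big_split /= (bigD1 j)//= big1 => [|k kj].
  rewrite addr0 -scalerDr aa eqxx mul1r -!scale_scalar_mx !scale_scalar_mx.
  by congr (_%:M); rewrite mulrC.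
rewrite [X in _ + X *: _]mulrC -scalerDr aa eq_sym (negbTE kj) mul0r.
by rewrite scale_scalar_mx mulr0 raddf0.
Qed.

Lemma sigma_mx_beta x : sigma_mx x * beta + beta * sigma_mx x = 0.
Proof.
have [_ _ _ ab _] := dirac.
rewrite /sigma_mx mulr_suml mulr_sumr -big_split big1// => j _ /=.
by rewrite -scalerAl -scalerAr -scalerDr ab scaler0.
Qed.

Lemma conjcM (z w : C) : conjc (z * w) = conjc z * conjc w.
Proof.
by case: z => a b; case: w => k l; apply/eqP; rewrite eq_complex /=;
  apply/andP; split; apply/eqP; ring.
Qed.

Lemma conjc_sum (I : Type) (r : seq I) (F : I -> C) :
  conjc (\sum_(i <- r) F i) = \sum_(i <- r) conjc (F i).
Proof.
apply: (big_morph (@conjc R)) => [z w|]; last by rewrite /= oppr0.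
by case: z => a b; case: w => k l; rewrite /= opprD.
Qed.

Lemma hermitian_sigma_mx x : Defs.hermitian (sigma_mx x).
Proof.
have [ha _ _ _ _] := dirac.
apply/matrixP => a c; rewrite !mxE !summxE conjc_sum; apply: eq_bigr => j _.
rewrite [in LHS]mxE [in RHS]mxE conjcM /= oppr0; congr (_ * _).
by have /matrixP/(_ a c) := ha j; rewrite !mxE.
Qed.

Lemma dirac_symbol_sqr (m : R) p :
  dirac_symbol alpha beta m p * dirac_symbol alpha beta m p = ((energy m p ^+ 2)%:C)%:M.
Proof.
have [_ _ _ _ bb] := dirac.
rewrite /dirac_symbol -/(sigma_mx p) mulrDl !mulrDr sigma_mx_sqr.
rewrite -!scalerAl -!scalerAr bb addrA -[X in X + _]addrA -scalerDr sigma_mx_beta.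
rewrite scaler0 addr0 scalerA -scalemx1 -scalerDl scalemx1; congr (_%:M).
rewrite /energy sqr_sqrtr ?addr_ge0 ?sqnorm3_ge0 ?sqr_ge0//.
by rewrite -rmorphM -rmorphD.
Qed.

(** If [beta] were [-1], anticommutation would force [alpha ord0 = 0], against its square being 1.
    So [1 + beta] has a nonzero column, and [beta * (1 + beta) = 1 + beta] makes that column
    fixed. *)
Lemma exists_beta_fixed : exists2 chi : 'cV[C]_4, chi != 0 & beta *m chi = chi.
Proof.
have [_ _ aa ab bb] := dirac.
have nz : 1 + beta != 0.
  apply/eqP => h; have b1 : beta = -1 by apply/eqP; rewrite -addr_eq0 addrC h.
  have := ab ord0; rewrite b1 mulrN1 mulN1r => /eqP; rewrite -opprD oppr_eq0 => /eqP a0.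
  have := aa ord0 ord0; rewrite eqxx mul1r -mulrDr a0 mulr0 => /matrixP/(_ 0 0)/eqP.
  by rewrite !mxE eqxx mulr1n eq_sym pnatr_eq0.
have [j hj] : exists j, col j (1 + beta) != 0.
  apply/existsP; apply: contraNT nz; rewrite negb_exists => /forallP h.
  apply/eqP/matrixP => k j; have := h j; rewrite negbK => /eqP/matrixP/(_ k 0).
  by rewrite !mxE.
exists (col j (1 + beta)) => //.
rewrite colE mulmxA -[beta *m _]/(beta * (1 + beta)) mulrDr mulr1 bb.
by rewrite addrC.
Qed.

Definition vnorm2 (v : 'cV[C]_4) : R := \sum_(k < 4) csq (v k 0).

Lemma vnorm2E v : (vnorm2 v)%:C = (map_mx conjc v^T *m v) 0 0.
Proof.
rewrite /vnorm2 rmorph_sum mxE; apply: eq_bigr => k _.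
rewrite !mxE; case: (v k 0) => a c; rewrite /csq /=; apply/eqP.
by rewrite eq_complex /=; apply/andP; split; apply/eqP; ring.
Qed.

Lemma vnorm2_gt0 v : v != 0 -> 0 < vnorm2 v.
Proof.
move=> v0; rewrite lt_neqAle sumr_ge0 ?andbT; last by move=> *; exact: csq_ge0.
apply: contra v0 => /eqP/esym/eqP; rewrite psumr_eq0; last by move=> *; exact: csq_ge0.
move=> /allP h; apply/eqP/matrixP => k j; rewrite (ord1 j) mxE.
have := h k (mem_index_enum _); rewrite /= /csq paddr_eq0 ?sqr_ge0// !sqrf_eq0.
by case: (v k 0) => a c /= /andP[/eqP -> /eqP ->].
Qed.

Lemma map_conjc_mul m n l (M : 'M[C]_(m, n)) (M' : 'M[C]_(n, l)) :
  map_mx (@conjc R) (M *m M') = map_mx (@conjc R) M *m map_mx (@conjc R) M'.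
Proof.
apply/matrixP => i j; rewrite !mxE conjc_sum; apply: eq_bigr => k _.
by rewrite conjcM !mxE.
Qed.

(* The cross terms cancel in (a - i c S)(a + i c S) = a^2 + c^2 S^2. *)
Lemma vnorm2_sigma_mx (a c : R) x (chi : 'cV[C]_4) :
  vnorm2 (a%:C *: chi + (0 +i* c) *: (sigma_mx x *m chi)) =
  (a ^+ 2 + sqnorm3 x * c ^+ 2) * vnorm2 chi.
Proof.
apply: (@complexI R); rewrite rmorphM /= !vnorm2E.
set M : 'M[C]_4 := (a%:C)%:M + (0 +i* c) *: sigma_mx x.
have -> : a%:C *: chi + (0 +i* c) *: (sigma_mx x *m chi) = M *m chi.
  by rewrite /M mulmxDl mul_scalar_mx scalemxAl.
rewrite trmx_mul map_conjc_mul -mulmxA (mulmxA _ M).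
have -> : map_mx conjc M^T *m M = ((a ^+ 2 + sqnorm3 x * c ^+ 2)%:C)%:M.
  have -> : map_mx conjc M^T = (a%:C)%:M - (0 +i* c) *: sigma_mx x.
    apply/matrixP => i j; have /matrixP/(_ i j) := hermitian_sigma_mx x.
    rewrite !mxE => <-; rewrite eq_sym; case: eqP => _; case: (sigma_mx x j i) => k l;
    by apply/eqP; rewrite eq_complex /=; apply/andP; split; apply/eqP; ring.
  have S2 : sigma_mx x *m sigma_mx x = ((sqnorm3 x)%:C)%:M by exact: sigma_mx_sqr.
  rewrite /M mulmxBl !mulmxDr !mul_scalar_mx mul_mx_scalar -!scalemxAl -!scalemxAr S2.
  rewrite opprD addrA addrK !scale_scalar_mx -raddfB; congr (_%:M).
  by apply/eqP; rewrite eq_complex /=; apply/andP; split; apply/eqP; ring.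
by rewrite mul_scalar_mx -scalemxAr mxE.
Qed.

(** [E + D] is [2 E] times the projection onto the positive-energy eigenspace; the identity is
    [D (E + D) = E (E + D)], a consequence of [D^2 = E^2]. *)
Lemma dirac_symbol_eigenvector (m : R) p (v : 'cV[C]_4) :
  let E := (energy m p)%:C in
  dirac_symbol alpha beta m p *m (E *: v + dirac_symbol alpha beta m p *m v) =
  E *: (E *: v + dirac_symbol alpha beta m p *m v).
Proof.
move=> E; rewrite mulmxDr mulmxA [X in X *m v](dirac_symbol_sqr m p) mul_scalar_mx.
by rewrite -scalemxAr scalerDr addrC scalerA -rmorphM.
Qed.

End dirac_algebra.

(** * Square integrability, and passage from cosine integrals to complex ones *)

Section square_integrable.
Context {R : realType}.
Local Open Scope complex_scope.

Lemma csq_real (r : R) : csq (r%:C) = r ^+ 2.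
Proof. by rewrite /csq /= expr0n addr0. Qed.

Lemma csqD_le (z w : R[i]) : csq (z + w) <= 2 * csq z + 2 * csq w.
Proof.
case: z => a c; case: w => k l; rewrite /csq /=.
by have := sqr_ge0 (a - k); have := sqr_ge0 (c - l); nra.
Qed.

Lemma cL2_le (f : R3 R -> R[i]) (g : R3 R -> R) : cmfun f ->
  (forall x, csq (f x) <= g x) -> (leb3 R).-integrable setT (EFin \o g) -> cL2 f.
Proof.
move=> mf fg gi; split => //; have [f1 f2] := mf.
have : (leb3 R).-integrable setT (EFin \o (fun x => csq (f x))).
  apply: (@le_integrable_fun _ _ _ _ _ g) => //.
    by apply: measurable_funD; exact: measurable_funX.
  by move=> x; rewrite ger0_norm ?csq_ge0.
by move/integrable_lty; apply.
Qed.

Lemma cL2_integrable (f : R3 R -> R[i]) : cL2 f ->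
  (leb3 R).-integrable setT (EFin \o (fun x => csq (f x))).
Proof.
move=> [[f1 f2] fi]; apply/integrableP; split.
  by apply/measurable_EFinP; apply: measurable_funD; exact: measurable_funX.
by under eq_integral do rewrite /= ger0_norm ?csq_ge0//.
Qed.

Lemma cL2D (f g : R3 R -> R[i]) : cL2 f -> cL2 g -> cL2 (fun x => f x + g x).
Proof.
move=> f2 g2; have [mf _] := f2; have [mg _] := g2.
apply: (@cL2_le _ (fun x => 2 * csq (f x) + 2 * csq (g x))); first exact: cmfunD.
  by move=> x; exact: csqD_le.
by apply: integrable_fun_add; apply: integrable_fun_mulr; exact: cL2_integrable.
Qed.

Lemma cL2Zl (z : R[i]) (f : R3 R -> R[i]) : cL2 f -> cL2 (fun x => z * f x).
Proof.
move=> f2; have [mf _] := f2.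
apply: (@cL2_le _ (fun x => csq z * csq (f x))).
- exact: cmfunM (cmfun_cst _ z) mf.
- by move=> x; rewrite csqM.
- by apply: integrable_fun_mulr; exact: cL2_integrable.
Qed.

Lemma cL2_real_le (u g : R3 R -> R) : measurable_fun setT u ->
  (forall x, u x ^+ 2 <= g x) -> (leb3 R).-integrable setT (EFin \o g) ->
  cL2 (fun x => (u x)%:C).
Proof.
move=> mu ug gi; have mf := cmfun_real mu.
by apply: (cL2_le mf _ gi) => x; rewrite csq_real.
Qed.

Lemma cL2_sum (I : Type) (r : seq I) (F : I -> R3 R -> R[i]) :
  (forall i, cL2 (F i)) -> cL2 (fun x => \sum_(i <- r) F i x).
Proof.
move=> Fi; elim: r => [|i r ih].
  under eq_fun do rewrite big_nil.
  apply: (@cL2_le _ (fun=> 0)); first exact: cmfun_cst.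
    by move=> x; rewrite /csq /= expr0n addr0.
  exact: integrable0.
by under eq_fun do rewrite big_cons; exact: cL2D.
Qed.

(** The real part is the hypothesis at [c = 0], the imaginary part its opposite at [c = - pi / 2]; a
    phase [th] becomes the factor [exp(- i th)]. *)
Lemma Cint_expi_real (u : R3 R -> R) p (a th : R) :
  (leb3 R).-integrable setT (EFin \o u) ->
  (forall c, \int[leb3 R]_x (u x * cos (c + dot3 p x)) = a * cos (c + th)) ->
  Cint (leb3 R) (fun x => conjc (expi (dot3 p x)) * (u x)%:C) = a%:C * conjc (expi th).
Proof.
move=> ui h; rewrite /Cint.
have E1 x : complex.Re (conjc (expi (dot3 p x)) * (u x)%:C) = u x * cos (0 + dot3 p x).
  by rewrite /expi /= mulr0 subr0 add0r mulrC.
have E2 x : complex.Im (conjc (expi (dot3 p x)) * (u x)%:C) =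
    -1 * (u x * cos (- (pi / 2) + dot3 p x)).
  by rewrite addrC cos_subpihalf /expi /= mulr0 add0r mulN1r mulNr mulrC.
under eq_Rintegral do rewrite E1.
under [X in _ +i* X]eq_Rintegral do rewrite E2.
rewrite RintegralZl//; last first.
  apply: integrable_mul_cos => //; apply: measurable_funD => //.
  exact: measurable_dot3.
rewrite !h add0r (addrC (- _)) cos_subpihalf.
by apply/eqP; rewrite eq_complex /=; apply/andP; split; apply/eqP; ring.
Qed.

End square_integrable.

(** * The wave packet, its transform and its positive energy *)

Section packet.
Context {R : realType}.
Local Open Scope complex_scope.
Variables (alpha : 'I_3 -> 'M[R[i]]_4) (beta : 'M[R[i]]_4).
Hypothesis dirac : dirac_matrices alpha beta.
Variables (m b s : R) (chi : 'cV[R[i]]_4).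
Hypotheses (m0 : 0 < m) (b0 : 0 < b) (bchi : beta *m chi = chi).
Local Notation I1 := (0 +i* 1 : R[i]).

(** Here [s] is the normalizing factor, no longer the mixing variable. The factor [I1] compensates
    the phase [pi / 2] in the transform of [x_j B]. *)
Definition packet : spinor R := fun x =>
  (s%:C * (Acoef m b x)%:C) *: chi +
  \sum_(j < 3) (s%:C * I1 * (Defs.coord x j * Bcoef m b x)%:C) *: (alpha j *m chi).

Definition damping (p : R3 R) : R := expR (- (b ^+ 2 * sqnorm3 p / 2)).

Definition packet_hat : spinor R := fun p =>
  (s%:C * (damping p * (1 + m / energy m p))%:C) *: chi +
  \sum_(j < 3) (s%:C * (damping p * (Defs.coord p j / energy m p))%:C) *: (alpha j *m chi).

Lemma energy_gt0 p : 0 < energy m p.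
Proof. by rewrite sqrtr_gt0 ltr_wpDl ?sqnorm3_ge0 ?exprn_gt0. Qed.

Lemma vnorm2Z (r : R) (v : 'cV[R[i]]_4) : vnorm2 (r%:C *: v) = r ^+ 2 * vnorm2 v.
Proof.
by rewrite /vnorm2 mulr_sumr; apply: eq_bigr => k _; rewrite mxE csqM csq_real.
Qed.

Lemma dens_packet x : dens packet x = s ^+ 2 * vnorm2 chi * kerdens m b x.
Proof.
rewrite /dens -/(vnorm2 (packet x)).
have -> : packet x = s%:C *: ((Acoef m b x)%:C *: chi +
    (0 +i* Bcoef m b x) *: (sigma_mx alpha x *m chi)).
  rewrite /packet scalerDr scalerA; congr (_ + _).
  rewrite /sigma_mx mulmx_suml !scaler_sumr; apply: eq_bigr => j _.
  rewrite -scalemxAl !scalerA; congr (_ *: _).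
  by apply/eqP; rewrite eq_complex /=; apply/andP; split; apply/eqP; ring.
by rewrite vnorm2Z (vnorm2_sigma_mx dirac) -/(kerdens m b x); ring.
Qed.

(** Because [beta] fixes [chi], the coefficient [E + m] of [chi] in [packet_hat] is that of
    [(E + D) chi], and the spinor is a real multiple of this eigenvector. *)
Lemma packet_hat_eigen p :
  dirac_symbol alpha beta m p *m packet_hat p = (energy m p)%:C *: packet_hat p.
Proof.
have E0 := energy_gt0 p.
have -> : packet_hat p = (s * damping p / energy m p)%:C *:
    ((energy m p)%:C *: chi + dirac_symbol alpha beta m p *m chi).
  rewrite /packet_hat /dirac_symbol mulmxDl -scalemxAl bchi mulmx_suml.
  rewrite addrCA -scalerDl [RHS]scalerDr [RHS]addrC scalerA scaler_sumr; congr (_ + _).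
    by congr (_ *: _); rewrite -!rmorphD -!rmorphM /=; congr (_%:C); field; rewrite gt_eqF.
  apply: eq_bigr => j _; rewrite -scalemxAl scalerA; congr (_ *: _).
  by rewrite -!rmorphM /=; congr (_%:C); field; rewrite gt_eqF.
by rewrite -scalemxAr (dirac_symbol_eigenvector dirac) !scalerA mulrC.
Qed.

Lemma packetE k x : packet x k 0 = (s%:C * chi k 0) * (Acoef m b x)%:C +
  \sum_(j < 3) (s%:C * I1 * (alpha j *m chi) k 0) * (Defs.coord x j * Bcoef m b x)%:C.
Proof.
rewrite mxE summxE mxE mulrAC; congr (_ + _); apply: eq_bigr => j _.
by rewrite mxE mulrAC.
Qed.

Lemma packet_hatE k p : packet_hat p k 0 =
  (s%:C * chi k 0) * (damping p * (1 + m / energy m p))%:C +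
  \sum_(j < 3) (s%:C * (alpha j *m chi) k 0) *
     (damping p * (Defs.coord p j / energy m p))%:C.
Proof.
rewrite mxE summxE mxE mulrAC; congr (_ + _); apply: eq_bigr => j _.
by rewrite mxE mulrAC.
Qed.

Lemma coord_sqr_le (x : R3 R) j : Defs.coord x j ^+ 2 <= sqnorm3 x.
Proof.
rewrite /sqnorm3 /dot3 (bigD1 j)//= -expr2 lerDl sumr_ge0// => i _.
by rewrite -expr2 sqr_ge0.
Qed.

(** Both [A^2] and [(x_j B)^2 <= |x|^2 B^2] are dominated by [kerdens], already known to be
    integrable. *)
Lemma cL2_packet k : cL2 (fun x => packet x k 0).
Proof.
rewrite (funext (packetE k)); have ik := integrable_kerdens m0 b0.
apply: cL2D; first apply: cL2Zl.
  apply: (cL2_real_le (measurable_Acoef m0 b0) _ ik) => x.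
  by rewrite lerDl mulr_ge0 ?sqr_ge0 ?sqnorm3_ge0.
apply: cL2_sum => j; apply: cL2Zl.
apply: (cL2_real_le _ _ ik).
  apply: measurable_funM; first exact: measurable_coord.
  exact: measurable_Bcoef.
move=> x; rewrite exprMn (@le_trans _ _ (sqnorm3 x * Bcoef m b x ^+ 2))//.
  by rewrite ler_wpM2r ?sqr_ge0 ?coord_sqr_le.
by rewrite lerDr sqr_ge0.
Qed.

Lemma cL2_damping (h : R3 R -> R) : measurable_fun setT h ->
  (forall p, `|h p| <= energy m p) ->
  cL2 (fun p => (damping p * (h p / energy m p))%:C).
Proof.
move=> mh hE.
have bV : 0 < b^-1 by rewrite invr_gt0.
have dE : damping = gauss3 b^-1.
  apply/funext => p; rewrite gauss3E /damping; congr (expR (- _)).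
  by rewrite exprVn; field; rewrite gt_eqF.
apply: (@cL2_real_le _ _ (gauss3 b^-1)); last exact: integrable_gauss3.
  apply: measurable_funM.
    by rewrite dE; apply/measurable_EFinP; apply: measurable_int (integrable_gauss3 bV).
  apply: measurable_funM => //.
  (* The maximum with 0 keeps the root away from 0 for every real [r], so the function is continuous
     on the whole line; it changes nothing at [r = |p|^2]. *)
  have mE : measurable_fun setT (fun r : R => (Num.sqrt (Num.max r 0 + m ^+ 2))^-1).
    apply: continuous_measurable_fun => r; apply: cvgV.
      by rewrite gt_eqF// sqrtr_gt0 ltr_wpDl ?exprn_gt0// le_max lexx orbT.
    apply: (continuous_comp (f := fun r : R => Num.max r 0 + m ^+ 2) (g := Num.sqrt)).
      apply: cvgD; last exact: cvg_cst.
      by apply: continuous_max; [exact: cvg_id|exact: cvg_cst].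
    exact: sqrt_continuous.
  have -> : (fun p => (energy m p)^-1) =
      (fun r : R => (Num.sqrt (Num.max r 0 + m ^+ 2))^-1) \o (@sqnorm3 R).
    by apply/funext => p; rewrite /energy /=; congr ((Num.sqrt (_ + _))^-1);
      rewrite max_l ?sqnorm3_ge0.
  exact: measurableT_comp mE measurable_sqnorm3.
move=> p; rewrite exprMn dE; have E0 := energy_gt0 p.
rewrite -[leRHS]mulr1 ler_pM ?sqr_ge0 ?gauss3_sqr_le//.
rewrite -[leRHS](expr1n R 2) -(real_normK (num_real (h p / _))).
rewrite lerXn2r ?nnegrE// normrM normfV (gtr0_norm E0) ler_pdivrMr// mul1r.
exact: hE.
Qed.

Lemma cL2_packet_hat k : cL2 (fun p => packet_hat p k 0).
Proof.
rewrite (funext (packet_hatE k)).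
have mE p : m <= energy m p.
  by rewrite -[leLHS](gtr0_norm m0) -sqrtr_sqr ler_wsqrtr// lerDr sqnorm3_ge0.
have mmE : measurable_fun setT (energy m).
  have ms : measurable_fun setT (Num.sqrt : R -> R).
    by apply: continuous_measurable_fun; exact: sqrt_continuous.
  have mq : measurable_fun setT (fun p : R3 R => sqnorm3 p + m ^+ 2).
    by apply: measurable_funD => //; exact: measurable_sqnorm3.
  exact: measurableT_comp ms mq.
apply: cL2D; first apply: cL2Zl.
  (* The constant 1 is written [E / E], so that both summands have the form covered by
     [cL2_damping]. *)
  have e p : (damping p * (1 + m / energy m p))%:C =
      (damping p * (energy m p / energy m p))%:C + (damping p * (m / energy m p))%:C.
    by rewrite divff ?gt_eqF ?energy_gt0// mulrDr rmorphD.
  rewrite (funext e); apply: cL2D; apply: cL2_damping => //.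
    by move=> p; rewrite gtr0_norm ?energy_gt0.
  by move=> p; rewrite gtr0_norm.
apply: cL2_sum => j; apply: cL2Zl; apply: cL2_damping; first exact: measurable_coord.
move=> p; rewrite -sqrtr_sqr ler_wsqrtr// (le_trans (coord_sqr_le p j))//.
by rewrite lerDl sqr_ge0.
Qed.

Lemma is_FT_packet : is_FT_spinor packet packet_hat.
Proof.
move=> k.
have cr (u : R3 R -> R) : (leb3 R).-integrable setT (EFin \o u) ->
    cintegrable (leb3 R) (fun x => (u x)%:C).
  move=> ui; split => //=; exact: integrable0.
have iA := cr _ (integrable_Acoef m0 b0).
have iB j := cr _ (integrable_coord_Bcoef m0 b0 j).
apply: is_FT_pointwise; last 2 first.
- exact: cL2_packet_hat.
- move=> p; have md := measurable_dot3 p.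
  have FA := cintegrable_conj_expiM md iA.
  have FB j := cintegrable_conj_expiM md (iB j).
  have e x : conjc (expi (dot3 p x)) * packet x k 0 =
     (s%:C * chi k 0) * (conjc (expi (dot3 p x)) * (Acoef m b x)%:C) +
     \sum_(j < 3) (s%:C * I1 * (alpha j *m chi) k 0) *
       (conjc (expi (dot3 p x)) * (Defs.coord x j * Bcoef m b x)%:C).
    rewrite packetE mulrDr mulrCA; congr (_ + _); rewrite mulr_sumr.
    by apply: eq_bigr => j _; rewrite mulrCA.
  have FB' j := cintegrableZl (s%:C * I1 * (alpha j *m chi) k 0) (FB j).
  rewrite (funext e) (CintD (cintegrableZl _ FA) (cintegrable_sum _ FB')).
  rewrite (CintZl _ FA) (Cint_sum _ FB').
  have hA c : \int[leb3 R]_x (Acoef m b x * cos (c + dot3 p x)) =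
     gauss3_const * damping p * (1 + m / energy m p) * cos (c + 0).
    by rewrite addr0 Acoef_fourier.
  rewrite (Cint_expi_real (integrable_Acoef m0 b0) hA).
  have eB j : Cint (leb3 R) (fun x => s%:C * I1 * (alpha j *m chi) k 0 *
       (conjc (expi (dot3 p x)) * (Defs.coord x j * Bcoef m b x)%:C)) =
     s%:C * I1 * (alpha j *m chi) k 0 *
     ((gauss3_const * damping p * (Defs.coord p j / energy m p))%:C * conjc (expi (pi / 2))).
    rewrite (CintZl _ (FB j)) (Cint_expi_real (integrable_coord_Bcoef m0 b0 j)
      (fun c => coord_Bcoef_fourier m0 b0 j c p)).
    by [].
  under eq_bigr do rewrite eB.
  have c1 : FT_const * (gauss3_const : R)%:C = 1.
    rewrite /FT_const /gauss3_const -rmorphM mulVf//.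
    by rewrite expf_neq0// gt_eqF// sqrtr_gt0 mulr_gt0// pi_gt0.
  have x0 : conjc (expi (0 : R)) = 1.
    by rewrite /expi cos0 sin0 /= oppr0.
  (* The factor [i] of the packet meets [exp(- i pi / 2) = - i]. *)
  have xi : I1 * conjc (expi (pi / 2 : R)) = 1.
    rewrite /expi cos_pihalf sin_pihalf; apply/eqP; rewrite eq_complex /=.
    by apply/andP; split; apply/eqP; ring.
  rewrite packet_hatE [RHS]mulrDr [in RHS]mulr_sumr; congr (_ + _).
    by rewrite x0 mulr1 -(mulrA gauss3_const) [in RHS]rmorphM [RHS]mulrCA (mulrA FT_const) c1 mul1r.
  apply: eq_bigr => j _; rewrite -(mulrA gauss3_const) [in RHS]rmorphM.
  have K (f g' a i' t d' y : R[i]) : f * g' = 1 -> i' * y = 1 ->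
    a * t * d' = f * (a * i' * t * (g' * d' * y)).
    move=> h1 h2; transitivity ((f * g') * (i' * y) * (a * t * d')).
      by rewrite h1 h2 !mul1r.
    by ring.
  exact: K.
- rewrite (funext (packetE k)); apply: cintegrableD.
    exact: cintegrableZl iA.
  by apply: cintegrable_sum => j; exact: cintegrableZl (iB j).
Qed.

Lemma in_Hplus_packet : in_Hplus alpha beta m packet.
Proof.
split; first exact: cL2_packet.
exists packet_hat; split; first exact: is_FT_packet.
by apply: aeW => p; exact: packet_hat_eigen.
Qed.

End packet.

(** The variance is at most the second moment, so the spread bound is used with [d = eps ^+ 2]. *)
Lemma exists_localized (R : realType) (alpha : 'I_3 -> 'M[R[i]]_4) (beta : 'M[R[i]]_4)
    (m eps : R) : dirac_matrices alpha beta -> 0 < m -> 0 < eps ->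
  exists psi : spinor R,
    [/\ in_Hplus alpha beta m psi, normalized psi,
        finite_second_moment psi & sigma psi < eps].
Proof.
move=> dirac m0 e0; have [chi chi0 bchi] := exists_beta_fixed dirac.
have e2 : 0 < eps ^+ 2 by rewrite exprn_gt0.
have [b b0 hb] := exists_small_spread m0 e2.
set J := \int[leb3 R]_x kerdens m b x in hb.
have J0 : 0 < J.
  apply: lt_le_trans (Rintegral_kerdens_ge m0 b0).
  by rewrite divr_gt0// mulr_gt0 ?gauss3_const_gt0// exprn_gt0// invr_gt0.
have n0 := vnorm2_gt0 chi0.
have nJ0 : 0 < vnorm2 chi * J by rewrite mulr_gt0.
(* Chosen so that [s^2 |chi|^2 J = 1]: the density becomes [kerdens] divided by its integral. *)
pose s := Num.sqrt (vnorm2 chi * J)^-1.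
have s2 : s ^+ 2 * vnorm2 chi = J^-1.
  by rewrite /s sqr_sqrtr ?invr_ge0 ?ltW//; field; rewrite !gt_eqF.
pose psi := packet alpha m b s chi.
have dE x : dens psi x = J^-1 * kerdens m b x by rewrite (dens_packet dirac) s2.
have ik := integrable_kerdens m0 b0.
have iq := integrable_sqnorm3_kerdens m0 b0.
have qE x : sqnorm3 x * dens psi x = J^-1 * (sqnorm3 x * kerdens m b x).
  by rewrite dE mulrCA.
have iqd := integrable_fun_mulr J^-1 iq.
exists psi; split.
- exact: in_Hplus_packet.
- rewrite /normalized; under eq_integral do rewrite dE.
  rewrite (integrable_section_EFin (integrable_fun_mulr J^-1 ik)) RintegralZl//.
  by rewrite -/J mulVf// gt_eqF.
- rewrite /finite_second_moment; under eq_integral do rewrite qE.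
  by rewrite (integrable_section_EFin iqd) ltry.
- have -> : eps = Num.sqrt (eps ^+ 2) by rewrite sqrtr_sqr gtr0_norm.
  rewrite /sigma ltr_sqrt//; apply: le_lt_trans
    (_ : J^-1 * \int[leb3 R]_x (sqnorm3 x * kerdens m b x) < _).
    rewrite /sigma2; under eq_Rintegral do rewrite qE.
    rewrite RintegralZl// gerBl//; apply: sumr_ge0 => j _; exact: sqr_ge0.
  by rewrite mulrC ltr_pdivrMr.
Qed.

Theorem theorem1 (R : realType) (alpha : 'I_3 -> 'M[R[i]]_4) (beta : 'M[R[i]]_4)
  (m : R) :
  dirac_matrices alpha beta -> 0 < m ->
  (forall eps : R, 0 < eps ->
     exists psi : spinor R,
       [/\ in_Hplus alpha beta m psi, normalized psi,
           finite_second_moment psi & sigma psi < eps])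
  /\
  (exists psis : nat -> spinor R,
     (forall n, [/\ in_Hplus alpha beta m (psis n), normalized (psis n)
                  & finite_second_moment (psis n)])
     /\ (fun n => sigma (psis n)) @ \oo --> (0 : R)).
Proof.
move=> dirac m0; split=> [eps e0|]; first exact: exists_localized.
have h n : exists psi : spinor R, [/\ in_Hplus alpha beta m psi, normalized psi,
    finite_second_moment psi & sigma psi < n.+1%:R^-1].
  by apply: exists_localized; rewrite ?invr_gt0.
have [psis hpsis] := choice h.
exists psis; split=> [n|]; first by have [] := hpsis n.
apply: (@squeeze_cvgr _ _ _ _ (cst 0) (fun n => harmonic n)).
- apply: nearW => n; have [_ _ _ /ltW hs] := hpsis n.
  by rewrite /sigma sqrtr_ge0.
- exact: cvg_cst.
- exact: cvg_harmonic.
Qed.
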